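(* Let $m\in\mathbb{R}$, $A\in\mathbb{C}^{2\times2}$, and let $z\in\mathbb{C}\setminus((-\infty,-|m|]\cup[|m|,+\infty))$ satisfy $\det\big(\sigma_0+\tfrac{i}{2}AZ(z)\big)\neq0$. Then $z$ lies in the resolvent set of $D_A$ and $(D_A-z)^{-1}$ is the integral operator on $L^2(\mathbb{R};\mathbb{C}^2)$ with kernel $$R^A_z(x,y)=R_z(x,y)-R_z(x,0)\Big(\sigma_0+\tfrac{i}{2}AZ(z)\Big)^{-1}AR_z(0,y).$$
   Context: Let $\sigma_0=I_2$, $\sigma_1=\begin{pmatrix}0&1\\1&0\end{pmatrix}$, $\sigma_3=\begin{pmatrix}1&0\\0&-1\end{pmatrix}$. Identify $L^2(\mathbb{R};\mathbb{C}^2)=L^2(\mathbb{R}_-;\mathbb{C}^2)\oplus L^2(\mathbb{R}_+;\mathbb{C}^2)$; for $\psi=\psi_-\oplus\psi_+\in H^1(\mathbb{R}_-;\mathbb{C}^2)\oplus H^1(\mathbb{R}_+;\mathbb{C}^2)$, $\psi(0_\pm)$ are the one-sided traces at $0$. Let $\mathscr{D}=-i\sigma_1\frac{d}{dx}+m\sigma_3$, and let $D_A$ be the operator with domain $\{\psi\in H^1(\mathbb{R}_-;\mathbb{C}^2)\oplus H^1(\mathbb{R}_+;\mathbb{C}^2) : (2i\sigma_1-A)\psi(0_+)=(2i\sigma_1+A)\psi(0_-)\}$ acting as $D_A\psi=\mathscr{D}\psi_-\oplus\mathscr{D}\psi_+$. Branch convention: $\mathrm{Im}\sqrt{w}>0$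 for $w\in\mathbb{C}\setminus[0,+\infty)$. For $z\in\mathbb{C}\setminus((-\infty,-|m|]\cup[|m|,+\infty))$ put $k(z)=\sqrt{z^2-m^2}$, $\zeta(z)=\frac{z+m}{k(z)}$, $Z(z)=\mathrm{diag}(\zeta(z),\zeta(z)^{-1})$, and $R_z(x,y)=\frac{i}{2}\big(Z(z)+\mathrm{sgn}(x-y)\sigma_1\big)e^{ik(z)|x-y|}$ (the integral kernel of $(D_0-z)^{-1}$, where $D_0$ is the free Dirac operator $\mathscr{D}$ on $H^1(\mathbb{R};\mathbb{C}^2)$); $R_z(x,0)$ and $R_z(0,y)$ are this formula with $\mathrm{sgn}(0)$ not needed for $x\neq0$, $y\neq 0$. *)

(* Defs.v *)
From HB Require Import structures.
From mathcomp Require Import all_boot all_order all_algebra.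
From mathcomp Require Import all_classical all_reals all_analysis.
From mathcomp Require Import complex.
Set Implicit Arguments. Unset Strict Implicit. Unset Printing Implicit Defensive.
Import Order.TTheory GRing.Theory Num.Theory.
Local Open Scope classical_set_scope.
Local Open Scope ring_scope.

Definition cre {R : realType} (w : R[i]) : R := let: Complex a _ := w in a.
Definition cim {R : realType} (w : R[i]) : R := let: Complex _ b := w in b.

Definition iC {R : realType} : R[i] := Complex 0 1.
Definition RtoC {R : realType} (a : R) : R[i] := Complex a 0.

Definition cexp {R : realType} (w : R[i]) : R[i] :=
  Complex (expR (cre w) * cos (cim w)) (expR (cre w) * sin (cim w)).

(* square root with the branch convention cim (sqrt w) > 0 for w outside
   [0,+oo): sqrtc w is *a* square root of w; we pick the one of +-sqrtc w
   with positive imaginary part. *)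
Definition csqrt_up {R : realType} (w : R[i]) : R[i] :=
  let s := sqrtc w in if 0 < cim s then s else - s.

Definition kz {R : realType} (m : R) (z : R[i]) : R[i] :=
  csqrt_up (z ^+ 2 - (RtoC m) ^+ 2).
Definition zeta {R : realType} (m : R) (z : R[i]) : R[i] := (z + RtoC m) / kz m z.

Definition sigma0 {R : realType} : 'M[R[i]]_2 := 1%:M.
Definition sigma1 {R : realType} : 'M[R[i]]_2 :=
  \matrix_(i < 2, j < 2) (if i == j then 0 else 1).
Definition sigma3 {R : realType} : 'M[R[i]]_2 :=
  \matrix_(i < 2, j < 2)
    (if i == j then (if (i : nat) == 0%N then 1 else -1) else 0).
Definition Zmat {R : realType} (m : R) (z : R[i]) : 'M[R[i]]_2 :=
  \matrix_(i < 2, j < 2)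
    (if i == j then (if (i : nat) == 0%N then zeta m z else (zeta m z)^-1) else 0).

Definition Rz {R : realType} (m : R) (z : R[i]) (x y : R) : 'M[R[i]]_2 :=
  (iC / 2%:R * cexp (iC * kz m z * RtoC `|x - y|)) *:
    (Zmat m z + RtoC (Num.sg (x - y)) *: sigma1).

Definition RAz {R : realType} (m : R) (A : 'M[R[i]]_2) (z : R[i]) (x y : R)
  : 'M[R[i]]_2 :=
  Rz m z x y -
  Rz m z x 0 *m invmx (sigma0 + (iC / 2%:R) *: (A *m Zmat m z)) *m A *m Rz m z 0 y.

Definition leb {R : realType} := @lebesgue_measure R.

Definition sqnorm {R : realType} (v : 'cV[R[i]]_2) : R :=
  \sum_(i < 2) (cre (v i 0) ^+ 2 + cim (v i 0) ^+ 2).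

Definition L2on {R : realType} (D : set R) (f : R -> 'cV[R[i]]_2) : Prop :=
  (forall i : 'I_2, measurable_fun D (fun x => cre (f x i 0)) /\
                    measurable_fun D (fun x => cim (f x i 0))) /\
  leb.-integrable D (fun x => (sqnorm (f x))%:E).

Definition L2sq {R : realType} (f : R -> 'cV[R[i]]_2) : R :=
  Rintegral leb setT (fun x => sqnorm (f x)).

Definition cintegrable {R : realType} (D : set R) (h : R -> R[i]) : Prop :=
  leb.-integrable D (fun x => (cre (h x))%:E) /\
  leb.-integrable D (fun x => (cim (h x))%:E).
Definition cint {R : realType} (D : set R) (h : R -> R[i]) : R[i] :=
  Complex (Rintegral leb D (fun x => cre (h x))) (Rintegral leb D (fun x => cim (h x))).
Definition vintegrable {R : realType} (D : set R) (F : R -> 'cV[R[i]]_2) : Prop :=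
  forall i : 'I_2, cintegrable D (fun y => F y i 0).
Definition vint {R : realType} (D : set R) (F : R -> 'cV[R[i]]_2) : 'cV[R[i]]_2 :=
  \col_(i < 2) cint D (fun y => F y i 0).

Definition Rpos {R : realType} : set R := [set x | 0 < x].
Definition Rneg {R : realType} : set R := [set x | x < 0].

(* H^1(R_+; C^2): u in L^2(R_+), with (weak) derivative g in L^2(R_+);
   u is (the locally absolutely continuous representative)
   u(x) = c + int_0^x g, so that c = u(0+) is the trace at 0. *)
Definition H1_pos {R : realType} (u g : R -> 'cV[R[i]]_2) (c : 'cV[R[i]]_2) : Prop :=
  L2on Rpos u /\ L2on Rpos g /\
  forall x : R, 0 < x -> u x = c + vint [set y | 0 < y <= x] g.
Definition H1_neg {R : realType} (u g : R -> 'cV[R[i]]_2) (c : 'cV[R[i]]_2) : Prop :=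
  L2on Rneg u /\ L2on Rneg g /\
  forall x : R, x < 0 -> u x = c - vint [set y | x <= y < 0] g.

(* u = u_- (+) u_+ is in dom(D_A), with derivatives gm, gp on R_-, R_+ and
   one-sided traces cm = u(0-), cp = u(0+):
   (2 i sigma1 - A) u(0+) = (2 i sigma1 + A) u(0-) *)
Definition in_dom_DA {R : realType} (A : 'M[R[i]]_2) (u gm gp : R -> 'cV[R[i]]_2)
  (cm cp : 'cV[R[i]]_2) : Prop :=
  H1_neg u gm cm /\ H1_pos u gp cp /\
  ((2%:R * iC) *: sigma1 - A) *m cp = ((2%:R * iC) *: sigma1 + A) *m cm.

(* the differential expression  -i sigma1 u' + m sigma3 u  (u' = g) *)
Definition Dexpr {R : realType} (m : R) (u g : R -> 'cV[R[i]]_2) (x : R) : 'cV[R[i]]_2 :=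
  - iC *: (sigma1 *m g x) + RtoC m *: (sigma3 *m u x).

Definition intop {R : realType} (K : R -> R -> 'M[R[i]]_2) (f : R -> 'cV[R[i]]_2)
  : R -> 'cV[R[i]]_2 :=
  fun x => vint setT (fun y => K x y *m f y).

(* "z is in the resolvent set of D_A and (D_A - z)^{-1} is the integral operator
   with kernel K":
   (i)  D_A - z is injective on dom(D_A);
   (ii) for every f in L^2(R;C^2) the integral (Kf)(x) exists (x <> 0),
        Kf lies in dom(D_A) and (D_A - z)(Kf) = f  (so D_A - z is onto and
        its inverse is the integral operator);
   (iii) the integral operator is bounded on L^2. *)
Definition resolvent_is_intop {R : realType} (m : R) (A : 'M[R[i]]_2) (z : R[i])
  (K : R -> R -> 'M[R[i]]_2) : Prop :=
  (forall (u gm gp : R -> 'cV[R[i]]_2) (cm cp : 'cV[R[i]]_2),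
      in_dom_DA A u gm gp cm cp ->
      {ae leb, forall x, x < 0 -> Dexpr m u gm x - z *: u x = 0} ->
      {ae leb, forall x, 0 < x -> Dexpr m u gp x - z *: u x = 0} ->
      {ae leb, forall x, u x = 0}) /\
  (forall f : R -> 'cV[R[i]]_2, L2on setT f ->
      (forall x : R, x != 0 -> vintegrable setT (fun y => K x y *m f y)) /\
      exists (gm gp : R -> 'cV[R[i]]_2) (cm cp : 'cV[R[i]]_2),
        in_dom_DA A (intop K f) gm gp cm cp /\
        {ae leb, forall x, x < 0 -> Dexpr m (intop K f) gm x - z *: intop K f x = f x} /\
        {ae leb, forall x, 0 < x -> Dexpr m (intop K f) gp x - z *: intop K f x = f x}) /\
  (exists M : R, forall f : R -> 'cV[R[i]]_2, L2on setT f ->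
      L2sq (intop K f) <= M * L2sq f).

(* Main.v *)
(** Away from the interface [(D_A - z) u = f] is the linear system
    [u' = i sigma1 (f + (z - m sigma3) u)], which the combinations
    [u_1 + zeta u_2] and [u_1 - zeta u_2] decouple into [w' = i k w + ...] and
    [w' = - i k w + ...].  Multiplying by an exponential solves these equations;
    the product rule for absolutely continuous functions that this uses is
    Fubini's theorem on a triangle.

    For [f = 0], square integrability leaves only the modes
    [exp (i k |x|) (sgn x zeta, 1)], and the transmission condition on their
    two amplitudes is [(1 + i/2 A Z) h = 0] for some [h] that determines them.
    For general [f], the free resolvent is
    [R_z f = i/2 ((Z + sigma1) P + (Z - sigma1) Q)] with [P' = i k P + f] and
    [Q' = - i k Q - f]; subtracting [R_z(., 0) h] shifts [P] on the right
    half-line and [Q] on the left one by a solution of the homogeneous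
    equation, and the transmission condition becomes
    [(1 + i/2 A Z) h = A (R_z f)(0)].

    Boundedness is the Schur test: the whole kernel, including its rank-one part,
    is dominated by [C exp (- kappa |x - y|)] with [kappa = Im k > 0]. *)
Require Import Defs.
From HB Require Import structures.
From mathcomp Require Import all_boot all_order all_algebra.
From mathcomp Require Import all_classical all_reals all_analysis.
From mathcomp Require Import measurable_realfun complex ring lra.
Set Implicit Arguments. Unset Strict Implicit. Unset Printing Implicit Defensive.
Import Order.TTheory GRing.Theory Num.Theory.
Import numFieldNormedType.Exports.
Local Open Scope classical_set_scope.
Local Open Scope ring_scope.

(** * Complex arithmetic and the spectral parameters *)

(** The transmission condition is best read as [2 i sigma1 (u(0+) - u(0-)) = A (u(0+) + u(0-))].
    Subtracting [R_z(., 0) h] from a function that is continuous at [0] with value [v] creates the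
    jump [- i sigma1 h] and makes the sum of the traces [2 v - i Z h]. Since [sigma1^2 = 1], the
    condition collapses to [2 h = A (2 v - i Z h)]. The same matrix therefore decides both
    questions: [v = 0] for uniqueness, where invertibility forces [h = 0], and [v = (R_z f)(0)] for
    existence, where it determines [h] and hence the kernel.

    Elements of the domain are only absolutely continuous on each half-line, the equation holds
    almost everywhere, and the value at [0] is tied to neither trace. Differential equations are
    therefore kept in integral form on bounded intervals, and each one-sided trace is realised as
    the value at [0] of an auxiliary function that agrees with the given one on one side only. *)

Section ComplexNumbers.
Context {R : realType}.
Implicit Types (v w : R[i]) (a b : R).

Lemma complex_ext v w : cre v = cre w -> cim v = cim w -> v = w.
Proof. by case: v => a b; case: w => c d /= -> ->. Qed.

Lemma creD v w : cre (v + w) = cre v + cre w. Proof. by case: v; case: w. Qed.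
Lemma cimD v w : cim (v + w) = cim v + cim w. Proof. by case: v; case: w. Qed.
Lemma creN w : cre (- w) = - cre w. Proof. by case: w. Qed.
Lemma cimN w : cim (- w) = - cim w. Proof. by case: w. Qed.
Lemma creM v w : cre (v * w) = cre v * cre w - cim v * cim w.
Proof. by case: v; case: w. Qed.
Lemma cimM v w : cim (v * w) = cre v * cim w + cim v * cre w.
Proof. by case: v => a b; case: w => c d /=; rewrite [LHS]/=. Qed.

Lemma RtoC0 : RtoC 0 = 0 :> R[i]. Proof. by []. Qed.
Lemma RtoC1 : RtoC 1 = 1 :> R[i]. Proof. by []. Qed.
Lemma RtoCD a b : RtoC (a + b) = RtoC a + RtoC b.
Proof. by apply: complex_ext; rewrite ?creD ?cimD //= addr0. Qed.
Lemma RtoCN a : RtoC (- a) = - RtoC a.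
Proof. by apply: complex_ext; rewrite ?creN ?cimN //= oppr0. Qed.
Lemma creMR w a : cre (w * RtoC a) = cre w * a.
Proof. by rewrite creM mulr0 subr0. Qed.
Lemma cimMR w a : cim (w * RtoC a) = cim w * a.
Proof. by rewrite cimM mulr0 add0r. Qed.

Lemma iC_sqr : iC * iC = -1 :> R[i].
Proof. by apply: complex_ext; rewrite ?creM ?cimM /=; ring. Qed.

(* The l^1 norm on [C = R^2]: unlike the modulus it involves no square root. *)
Definition norm1 w : R := `|cre w| + `|cim w|.

Lemma norm1_ge0 w : 0 <= norm1 w. Proof. by rewrite addr_ge0. Qed.

Lemma norm1D v w : norm1 (v + w) <= norm1 v + norm1 w.
Proof.
rewrite /norm1 creD cimD addrACA.
by apply: lerD; apply: ler_normD.
Qed.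

Lemma norm1N w : norm1 (- w) = norm1 w.
Proof. by rewrite /norm1 creN cimN !normrN. Qed.

Lemma norm1M v w : norm1 (v * w) <= norm1 v * norm1 w.
Proof.
rewrite /norm1 creM cimM.
have h1 := ler_normB (cre v * cre w) (cim v * cim w).
have h2 := ler_normD (cre v * cim w) (cim v * cre w).
rewrite !normrM in h1 h2.
nra.
Qed.

Lemma norm1_sqr_le w : norm1 w ^+ 2 <= 2 * (cre w ^+ 2 + cim w ^+ 2).
Proof.
rewrite /norm1 -(real_normK (num_real (cre w))) -(real_normK (num_real (cim w))).
have := sqr_ge0 (`|cre w| - `|cim w|); nra.
Qed.

Lemma le_norm1_sqr w : cre w ^+ 2 + cim w ^+ 2 <= norm1 w ^+ 2.
Proof.
rewrite /norm1 -(real_normK (num_real (cre w))) -(real_normK (num_real (cim w))).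
have := normr_ge0 (cre w); have := normr_ge0 (cim w); nra.
Qed.

Lemma norm1_sum n (F : 'I_n -> R[i]) : norm1 (\sum_i F i) <= \sum_i norm1 (F i).
Proof.
elim/big_ind2 : _ => //; first by rewrite /norm1 /= normr0 addr0.
by move=> x1 x2 y1 y2 h1 h2; apply: (le_trans (norm1D _ _)); apply: lerD.
Qed.

Lemma cexpD v w : cexp (v + w) = cexp v * cexp w.
Proof.
apply: complex_ext; rewrite ?creM ?cimM /= creD cimD expRD ?cosD ?sinD; ring.
Qed.

Lemma cexp0 : cexp (0 : R[i]) = 1.
Proof. by apply: complex_ext => /=; rewrite ?cos0 ?sin0 expR0 ?mulr1 ?mulr0. Qed.

Lemma cexpNM w : cexp (- w) * cexp w = 1.
Proof. by rewrite -cexpD addNr cexp0. Qed.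

Lemma norm1_cexp w : norm1 (cexp w) <= 2 * expR (cre w).
Proof.
rewrite /norm1 /= !normrM gtr0_norm ?expR_gt0//.
have c1 : `|cos (cim w)| <= 1 by rewrite ler_norml cos_geN1 cos_le1.
have s1 : `|sin (cim w)| <= 1 by rewrite ler_norml sin_geN1 sin_le1.
have := expR_gt0 (cre w); nra.
Qed.

Lemma normsq_cexp w : cre (cexp w) ^+ 2 + cim (cexp w) ^+ 2 = expR (cre w) ^+ 2.
Proof. by rewrite /= !exprMn -mulrDr cos2Dsin2 mulr1. Qed.

End ComplexNumbers.

(** * The branch of the square root and the parameters [k] and [zeta] *)

Section Spectral.
Context {R : realType}.
Implicit Types (m : R) (z w : R[i]).

Lemma csqrt_up_sqr w : csqrt_up w ^+ 2 = w.
Proof. by rewrite /csqrt_up; case: ifP => _; rewrite ?sqrrN sqr_sqrtc. Qed.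

(** A root with zero imaginary part is real and its square lies on [[0, +oo)]. Away from that ray a
    root without positive imaginary part thus has a strictly negative one, and the change of sign
    repairs it. *)
Lemma csqrt_up_gt0 w : ~ (cim w = 0 /\ 0 <= cre w) -> 0 < cim (csqrt_up w).
Proof.
move=> wN; rewrite /csqrt_up; case: ifPn => //; rewrite -leNgt cimN oppr_gt0.
rewrite le_eqVlt => /predU1P[s0|//]; exfalso; apply: wN.
have := sqr_sqrtc w; move: s0; case: (sqrtc w) => a b /= -> <-.
by rewrite expr2 creM cimM /= !mulr0 mul0r addr0 subr0 -expr2 sqr_ge0.
Qed.

Variables (m : R) (z : R[i]).
Hypothesis z_resolvent : ~ (cim z = 0 /\ `|m| <= `|cre z|).

Lemma kz_sqr : kz m z ^+ 2 = (z + RtoC m) * (z - RtoC m).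
Proof. by rewrite /kz csqrt_up_sqr; ring. Qed.

(** The imaginary part of [z^2 - m^2] is [2 Re z Im z]. If it vanishes and the real part is
    nonnegative, then either [z] is real with [|m| <= |z|], or [z] is imaginary and
    [- (Im z)^2 - m^2 >= 0] forces [z = m = 0]. Both cases are excluded by [z_resolvent]. *)
Lemma kz_gt0 : 0 < cim (kz m z).
Proof.
apply: csqrt_up_gt0; rewrite !expr2 creD cimD creN cimN !creM !cimM /=.
move=> [h1 h2]; apply: z_resolvent.
have {h1} : cim z = 0 \/ cre z = 0.
  have : cim z * cre z = 0 by lra.
  by move/eqP; rewrite mulf_eq0 => /orP[]/eqP; [left|right].
move=> [y0|x0].
  split=> //; rewrite -ler_sqr ?nnegrE// !real_normK ?num_real//.
  by rewrite y0 in h2; rewrite !expr2; lra.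
rewrite x0 in h2.
have y0 : cim z = 0 by nra.
have m0 : m = 0 by rewrite y0 in h2; nra.
by rewrite m0 normr0.
Qed.

Lemma kz_neq0 : kz m z != 0.
Proof. by apply/eqP => k0; have := kz_gt0; rewrite k0 /= ltxx. Qed.

Lemma zDm_neq0 : z + RtoC m != 0.
Proof.
apply/eqP => h; have := kz_sqr; rewrite h mul0r => /eqP.
by rewrite sqrf_eq0 (negPf kz_neq0).
Qed.

Lemma zeta_neq0 : zeta m z != 0.
Proof. by rewrite mulf_neq0 ?invr_eq0 ?kz_neq0 ?zDm_neq0. Qed.

Lemma zeta_kz : zeta m z * kz m z = z + RtoC m.
Proof. by rewrite /zeta divfK ?kz_neq0. Qed.

Lemma zeta_zBm : zeta m z * (z - RtoC m) = kz m z.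
Proof.
by rewrite /zeta mulrAC -kz_sqr expr2 mulfK ?kz_neq0.
Qed.

End Spectral.

(** * Schur test for the exponential kernel *)

Section RealIntegrals.
Context {R : realType}.
Local Notation mu := (@lebesgue_measure R).
Implicit Types (kap C x y : R) (phi : R -> R) (h : R * R -> R).

(** The inner integral is the difference of the integrals of the positive and negative parts, and
    Tonelli makes each of them measurable in [x]. *)
Lemma measurable_Rintegral h : measurable_fun setT h ->
  measurable_fun setT (fun x => \int[mu]_y h (x, y)).
Proof.
move=> mh; rewrite /Rintegral; apply: measurableT_comp => //.
have mE : measurable_fun setT (EFin \o h) by exact/measurable_EFinP.
under eq_fun do rewrite integralE.
apply: emeasurable_funB.
- rewrite (_ : (fun x => _) = fubini_F mu (EFin \o h)^\+%E).
    apply: measurable_fun_fubini_tonelli_F; first exact: measurable_funepos.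
    exact: funepos_ge0.
  by apply/funext => x; apply: eq_integral => y _; rewrite !funeposE.
- rewrite (_ : (fun x => _) = fubini_F mu (EFin \o h)^\-%E).
    apply: measurable_fun_fubini_tonelli_F; first exact: measurable_funeneg.
    exact: funeneg_ge0.
  by apply/funext => x; apply: eq_integral => y _; rewrite !funenegE.
Qed.

Lemma continuous_expR_scale kap (c : R) : continuous (fun y : R => expR (kap * (y - c))).
Proof.
move=> y; apply: continuous_comp; last exact: continuous_expR.
by apply: cvgM; [exact: cvg_cst|apply: cvgB; [exact: cvg_id|exact: cvg_cst]].
Qed.

Lemma integral_exp_right kap x : 0 < kap ->
  (\int[mu]_(y in `[x, +oo[) (expR (- kap * (y - x)))%:E)%E = (kap^-1)%:E.
Proof.
move=> k0.
pose F y := - kap^-1 * expR (- kap * (y - x)).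
have dF y : is_derive y 1 F (expR (- kap * (y - x))).
  rewrite /F; apply: is_derive_eq.
  by rewrite subr0 /GRing.scale /= mulr1; field; rewrite gt_eqF.
rewrite (@ge0_continuous_FTC2y _ _ F x 0).
- by rewrite /F subrr mulr0 expR0 mulr1 sub0e EFinN oppeK.
- by move=> y _; exact: expR_ge0.
- exact/continuous_subspaceT/continuous_expR_scale.
- rewrite /F -[X in _ --> X](mulr0 (- kap^-1)); apply: cvgM; first exact: cvg_cst.
  have -> : (fun y => expR (- kap * (y - x))) = (fun y => expR (- y)) \o (fun y => kap * (y - x)).
    by apply/funext => y /=; rewrite mulNr.
  apply: cvg_comp; last exact: cvgr_expR.
  apply: gt0_cvgMry => //.
  by apply: cvg_addrr => //.
- by move=> y _; have [] := dF y.
- apply: cvg_at_right_filter; apply: differentiable_continuous; apply/derivable1_diffP.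
  by have [] := dF x.
- by move=> y _; rewrite derive1E; exact: derive_val.
Qed.

Lemma integral_exp_left kap x : 0 < kap ->
  (\int[mu]_(y in `]-oo, x]) (expR (kap * (y - x)))%:E)%E = (kap^-1)%:E.
Proof.
move=> k0; rewrite -[x in LHS]opprK ge0_integration_by_substitutionNy.
- rewrite -(@integral_exp_right kap (- x) k0); apply: eq_integral => y _ /=.
  by congr (expR _)%:E; ring.
- exact/continuous_subspaceT/continuous_expR_scale.
- by move=> y _; exact: expR_ge0.
Qed.

Lemma measurable_exp_dist kap :
  measurable_fun setT (fun p : R * R => expR (- kap * `|p.1 - p.2|)).
Proof.
apply: measurableT_comp => //; apply: measurable_funM => //.
apply: measurableT_comp => //; apply: measurable_funB => //.
Qed.

Lemma measurable_exp_dist2 kap x :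
  measurable_fun setT (fun y => expR (- kap * `|x - y|)).
Proof.
apply: measurableT_comp => //; apply: measurable_funM => //.
by apply: measurableT_comp => //; apply: measurable_funB.
Qed.

Lemma integral_exp_dist kap x : 0 < kap ->
  (\int[mu]_y (expR (- kap * `|x - y|))%:E)%E = (2 / kap)%:E.
Proof.
move=> k0.
have -> : setT = `]-oo, x] `|` `]x, +oo[ :> set R.
  apply/esym/seteqP; split=> // y _ /=.
  by rewrite !in_itv /= andbT; case: (leP y x); [left|right].
rewrite ge0_integral_setU//=; last 2 first.
- by apply/measurable_EFinP; apply: measurable_funTS; exact: measurable_exp_dist2.
- rewrite disj_set2E; apply/eqP; rewrite -subset0 => y [] /=.
  by rewrite !in_itv /= andbT => h /(le_lt_trans h); rewrite ltxx.
rewrite integral_itv_obnd_cbnd; last first.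
  by apply/measurable_EFinP; apply: measurable_funTS; exact: measurable_exp_dist2.
have -> : (2 / kap = kap^-1 + kap^-1)%R by lra.
rewrite EFinD; congr (_ + _)%E.
- rewrite -(integral_exp_left x k0); apply: eq_integral => y.
  rewrite inE /= in_itv /= => yx; rewrite ger0_norm ?subr_ge0//.
  by congr (expR _)%:E; ring.
- rewrite -(integral_exp_right x k0); apply: eq_integral => y.
  rewrite inE /= in_itv /= andbT => yx; rewrite ler0_norm ?subr_le0//.
  by congr (expR _)%:E; ring.
Qed.

Lemma integrable_exp_dist kap x : 0 < kap ->
  mu.-integrable setT (fun y => (expR (- kap * `|x - y|))%:E).
Proof.
move=> k0; apply/integrableP; split.
  by apply/measurable_EFinP; exact: measurable_exp_dist2.
under eq_integral do rewrite gee0_abs ?lee_fin ?expR_ge0//.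
by rewrite integral_exp_dist// ltry.
Qed.

Lemma exp_dist_le1 kap x y : 0 < kap -> expR (- kap * `|x - y|) <= 1.
Proof.
by move=> k0; rewrite -expR0 ler_expR mulNr oppr_le0 mulr_ge0// ltW.
Qed.

Section Schur.
Variables (kap : R) (phi : R -> R).
Hypotheses (kap0 : 0 < kap) (mphi : measurable_fun setT phi).
Hypothesis iphi : mu.-integrable setT (fun y => (phi y ^+ 2)%:E).

Lemma integrable_exp_sqr x :
  mu.-integrable setT (fun y => (expR (- kap * `|x - y|) * phi y ^+ 2)%:E).
Proof.
apply: le_integrable iphi => //.
  apply/measurable_EFinP/measurable_funM; first exact: measurable_exp_dist2.
  exact: measurable_funX.
move=> y _; rewrite lee_fin normrM ger0_norm ?expR_ge0//.
by rewrite ler_piMl// exp_dist_le1.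
Qed.

(** From [|phi| <= 1 + phi^2]: the weight is integrable by itself, and bounded by 1 against
    [phi^2]. *)
Lemma integrable_exp_dom x : mu.-integrable setT
  (fun y => (expR (- kap * `|x - y|) * phi y)%:E).
Proof.
have := integrableD measurableT (integrable_exp_dist x kap0) (integrable_exp_sqr x).
apply: le_integrable => //.
  apply/measurable_EFinP/measurable_funM => //; exact: measurable_exp_dist2.
move=> y _; rewrite -EFinD lee_fin.
have e0 := expR_gt0 (- kap * `|x - y|).
rewrite normrM ger0_norm ?expR_ge0// [leRHS]ger0_norm; last first.
  by rewrite addr_ge0 ?expR_ge0// mulr_ge0 ?expR_ge0// sqr_ge0.
rewrite -{2}[expR _]mulr1 -mulrDr ler_wpM2l ?expR_ge0//.
rewrite -(real_normK (num_real (phi y))).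
have := sqr_ge0 (`|phi y| - 1); have := normr_ge0 (phi y); nra.
Qed.

(* Cauchy-Schwarz for the finite measure [exp (- kap |x - y|) dy]: expand
   [0 <= int E (phi - l)^2] at [l = (kap / 2) int E phi]. *)
Lemma sqr_exp_mean x :
  (\int[mu]_y (expR (- kap * `|x - y|) * phi y)) ^+ 2 <=
  2 / kap * \int[mu]_y (expR (- kap * `|x - y|) * phi y ^+ 2).
Proof.
set T := \int[mu]_y _; set S := \int[mu]_y _.
pose E y := expR (- kap * `|x - y|).
pose l := kap / 2 * T.
have iE := integrable_exp_dist x kap0.
have i1 := integrable_exp_dom x; have i2 := integrable_exp_sqr x.
have i1' := integrableZl measurableT (2 * l) i1.
have i0' := integrableZl measurableT (l ^+ 2) iE.
have : 0 <= \int[mu]_y (E y * phi y ^+ 2 - 2 * l * (E y * phi y) + l ^+ 2 * E y).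
  apply: Rintegral_ge0 => y _.
  have -> : E y * phi y ^+ 2 - 2 * l * (E y * phi y) + l ^+ 2 * E y =
    E y * (phi y - l) ^+ 2 by ring.
  by rewrite mulr_ge0 ?expR_ge0 ?sqr_ge0.
rewrite RintegralD//=; last first.
  by have := integrableB measurableT i2 i1'.
rewrite RintegralB// !RintegralZl//.
have -> : \int[mu]_y E y = 2 / kap by rewrite /Rintegral integral_exp_dist.
rewrite -/T -/S /l => h.
have {h} : 0 <= S - kap / 2 * T ^+ 2.
  apply: (le_trans h); rewrite le_eqVlt; apply/orP; left; apply/eqP; field.
  by rewrite gt_eqF.
rewrite subr_ge0 => h.
have -> : T ^+ 2 = 2 / kap * (kap / 2 * T ^+ 2) by field; rewrite gt_eqF.
by rewrite ler_wpM2l// divr_ge0// ltW.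
Qed.

Section SchurKernel.
Variables (C : R) (h : R * R -> R).
Hypothesis mh : measurable_fun setT h.
Hypothesis hC : forall x y, `|h (x, y)| <= C * (expR (- kap * `|x - y|) * phi y).

Lemma integrable_kernel x : mu.-integrable setT (fun y => (h (x, y))%:E).
Proof.
have := integrableZl measurableT C (integrable_exp_dom x).
apply: le_integrable => //.
  apply/measurable_EFinP; apply: (measurableT_comp mh).
  exact: pair1_measurable.
move=> y _; rewrite -EFinM /= lee_fin; apply: (le_trans (hC x y)).
exact: ler_norm.
Qed.

Lemma sqr_kernel_mean x : (\int[mu]_y h (x, y)) ^+ 2 <=
  C ^+ 2 * (2 / kap) * \int[mu]_y (expR (- kap * `|x - y|) * phi y ^+ 2).
Proof.
rewrite -mulrA; apply: le_trans (ler_wpM2l (sqr_ge0 C) (sqr_exp_mean x)).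
rewrite -exprMn.
have /esym cE := RintegralZl C measurableT (integrable_exp_dom x).
rewrite cE.
rewrite -(real_normK (num_real (\int[mu]_y h (x, y)))).
rewrite ler_sqr ?nnegrE//; last first.
  (* The dominating function is nonnegative because by [hC] it bounds an absolute value. *)
  by apply: Rintegral_ge0 => y _; exact: le_trans (normr_ge0 _) (hC x y).
apply: le_trans (le_normr_Rintegral measurableT (integrable_kernel x)) _.
apply: le_Rintegral => //.
- exact: integrable_norm (integrable_kernel x).
- by have := integrableZl measurableT C (integrable_exp_dom x).
Qed.

(** One factor [2 / kap] comes from Cauchy-Schwarz in [y], inside [sqr_kernel_mean]. The other
    appears when Tonelli exchanges the integrals and the weight is integrated in [x]. *)
Lemma integral_sqr_kernel :
  (\int[mu]_x ((\int[mu]_y h (x, y)) ^+ 2)%:E <=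
   ((C * (2 / kap)) ^+ 2)%:E * \int[mu]_y (phi y ^+ 2)%:E)%E.
Proof.
pose H p := (expR (- kap * `|p.1 - p.2|) * phi p.2 ^+ 2)%:E.
have mH : measurable_fun setT (H : _ -> \bar R).
  apply/measurable_EFinP/measurable_funM; first exact: measurable_exp_dist.
  by apply: measurable_funX; apply: measurableT_comp.
have H0 p : (0 <= H p)%E by rewrite lee_fin mulr_ge0 ?expR_ge0 ?sqr_ge0.
have c0 : 0 <= C ^+ 2 * (2 / kap) by rewrite mulr_ge0 ?sqr_ge0 ?divr_ge0 ?ltW.
have step : (\int[mu]_x ((\int[mu]_y h (x, y)) ^+ 2)%:E <=
    \int[mu]_x ((C ^+ 2 * (2 / kap))%:E * \int[mu]_y H (x, y)))%E.
  apply: ge0_le_integral => //.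
  - by move=> x _; rewrite lee_fin sqr_ge0.
  - by apply/measurable_EFinP; apply: measurable_funX; exact: measurable_Rintegral.
  - apply: measurable_funeM.
    exact: (measurable_fun_fubini_tonelli_F (m2 := mu) H mH H0).
  - move=> x _.
    have -> : (\int[mu]_y H (x, y))%E =
        (\int[mu]_y (expR (- kap * `|x - y|) * phi y ^+ 2))%:E.
      by rewrite /Rintegral fineK// integrable_fin_num//; exact: integrable_exp_sqr.
    by rewrite -EFinM lee_fin sqr_kernel_mean.
apply: (le_trans step); rewrite ge0_integralZl_EFin//; last 2 first.
- by move=> x _; exact: integral_ge0.
- exact: (measurable_fun_fubini_tonelli_F (m2 := mu) H mH H0).
rewrite fubini_tonelli//.
have -> : (\int[mu]_y \int[mu]_x H (x, y) =
           \int[mu]_y ((2 / kap)%:E * (phi y ^+ 2)%:E))%E.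
  apply: eq_integral => y _; rewrite /H /=.
  under eq_integral do rewrite EFinM muleC.
  rewrite ge0_integralZl_EFin ?sqr_ge0//; last first.
    apply/measurable_EFinP.
    under eq_fun do rewrite distrC.
    exact: measurable_exp_dist2.
  by under eq_integral do rewrite distrC; rewrite integral_exp_dist// muleC.
rewrite ge0_integralZl_EFin//; last 3 first.
- by move=> y _; rewrite lee_fin sqr_ge0.
- exact/measurable_EFinP/measurable_funX.
- by rewrite divr_ge0// ltW.
rewrite muleA -EFinM.
by have -> : (C ^+ 2 * (2 / kap) * (2 / kap) = (C * (2 / kap)) ^+ 2)%R by ring.
Qed.

Lemma integrable_sqr_kernel :
  mu.-integrable setT (fun x => ((\int[mu]_y h (x, y)) ^+ 2)%:E).
Proof.
apply/integrableP; split.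
  by apply/measurable_EFinP; apply: measurable_funX; exact: measurable_Rintegral.
under eq_integral do rewrite gee0_abs ?lee_fin ?sqr_ge0//.
apply: (le_lt_trans integral_sqr_kernel).
have /fineK <- := integrable_fin_num measurableT iphi.
by rewrite -EFinM ltry.
Qed.

End SchurKernel.
End Schur.

End RealIntegrals.

(** * Integration by parts for primitives of integrable functions *)

Section IntegrationByParts.
Context {R : realType}.
Local Notation mu := (@lebesgue_measure R).

Lemma EFin_Rintegral (D : set R) (f : R -> R) : measurable D ->
  mu.-integrable D (EFin \o f) ->
  (\int[mu]_(x in D) (f x)%:E)%E = (\int[mu]_(x in D) f x)%:E.
Proof. by move=> mD fi; rewrite /Rintegral fineK// integrable_fin_num. Qed.

Lemma Rintegral_derive (e e' : R -> R) (a b : R) : a <= b ->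
  (forall t : R, is_derive t 1 e (e' t)) -> continuous e' ->
  \int[mu]_(t in `[a, b]) e' t = e b - e a.
Proof.
rewrite le_eqVlt => /predU1P[->|ab] de ce'.
  by rewrite set_itv1 Rintegral_set1 subrr.
have ce t : {for t, continuous e}.
  apply: differentiable_continuous; apply/derivable1_diffP.
  by have [] := de t.
rewrite /Rintegral (@continuous_FTC2 _ _ e)//.
- exact: continuous_subspaceT.
- split.
  + by move=> t _; have [] := de t.
  + exact/cvg_at_right_filter/ce.
  + exact/cvg_at_left_filter/ce.
- by move=> t _; rewrite derive1E; exact: derive_val.
Qed.

Lemma continuous_bounded_itv (a b : R) (f : R -> R) : continuous f ->
  exists2 C, 0 <= C & forall t, a < t <= b -> `|f t| <= C.
Proof.
move=> cf; have [|M [_ MP]] := @compact_bounded _ _ (f @` `[a, b]).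
  apply: continuous_compact; last exact: segment_compact.
  exact: continuous_subspaceT.
exists (`|M| + 1); first by rewrite addr_ge0.
move=> t /andP[at_ tb].
apply: (MP (`|M| + 1)); first by rewrite (le_lt_trans (ler_norm _))// ltrDl.
by exists t => //=; rewrite in_itv /= ltW.
Qed.

Lemma continuous_integrable_itv (a b : R) (f : R -> R) : continuous f ->
  mu.-integrable `]a, b] (EFin \o f).
Proof.
move=> cf; have : mu.-integrable `[a, b] (EFin \o f).
  apply: continuous_compact_integrable; first exact: segment_compact.
  exact: continuous_subspaceT.
by apply: integrableS => //; exact: subset_itv_oc_cc.
Qed.

Lemma integrable_continuousM (a b : R) (f g : R -> R) : continuous f ->
  mu.-integrable `]a, b] (EFin \o g) ->
  mu.-integrable `]a, b] (EFin \o (fun t => f t * g t)).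
Proof.
move=> cf gi; have [C C0 fC] := continuous_bounded_itv a b cf.
have /integrableP[/measurable_EFinP mg _] := gi.
apply: le_integrable (integrableZl _ C gi) => //.
  apply/measurable_EFinP; apply: measurable_funM => //.
  by apply: measurable_funTS; exact: continuous_measurable_fun.
move=> t; rewrite /= in_itv /= => tab; rewrite lee_fin !normrM ler_wpM2r//.
by rewrite (ger0_norm C0) fC.
Qed.

Section ByParts.
Variables (a b : R) (e e' g : R -> R).
Hypothesis (de : forall t : R, is_derive t 1 e (e' t)).
Hypotheses (ce' : continuous e') (gi : mu.-integrable `]a, b] (EFin \o g)).

Let e0 : R -> R := e' \_ `]a, b].
Let g0 : R -> R := g \_ `]a, b].
(** The integrand [e'(t) g(s)] cut off to the triangle [a < s <= t <= b], in the variables [(t, s)].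
    Integrating in [s] first gives one side of [Rintegral_by_parts]; integrating in [t] first gives
    the other, since [e'] integrates to [e b - e s] over [[s, b]]. *)
Let kernel (p : R * R) := e0 p.1 * (\1_(`[0, +oo[%classic) (p.1 - p.2) * g0 p.2).

Let me0 : measurable_fun setT e0.
Proof.
apply/(measurable_restrictT _ _).1 => //.
by apply: measurable_funTS; exact: continuous_measurable_fun.
Qed.

Let g0i : mu.-integrable setT (EFin \o g0).
Proof. by rewrite /g0 -restrict_EFin; apply/integrable_restrict => //; rewrite setTI. Qed.

Let mg0 : measurable_fun setT g0.
Proof. by apply/measurable_EFinP; case/integrableP: g0i. Qed.

Let e0_bounded : exists2 C, 0 <= C & forall t, `|e0 t| <= C.
Proof.
have [C C0 eC] := continuous_bounded_itv a b ce'.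
exists C => // t; rewrite /e0 patchE; case: ifPn; last by rewrite normr0.
by rewrite inE /= in_itv /=; exact: eC.
Qed.

Let mkernel : measurable_fun setT kernel.
Proof.
apply: measurable_funM; first by apply: measurableT_comp.
apply: measurable_funM; last by apply: measurableT_comp.
apply: measurableT_comp; first exact: measurable_indic.
exact: measurable_funB.
Qed.

(** On the bounded interval the continuous function [e'] is at most some [C] in absolute value. The
    kernel is then dominated by the product of [C] times the indicator of []a, b]] in [t] with
    [|g0 s|]. *)
Let kernel_integrable : (mu \x mu)%E.-integrable setT (EFin \o kernel).
Proof.
have [C C0 eC] := e0_bounded.
apply/integrable12ltyP; first exact/measurable_EFinP.
pose G := \int[mu]_y `|g0 y|.
have gni : mu.-integrable setT (EFin \o (fun y => `|g0 y|)) by exact: integrable_norm.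
apply: (@le_lt_trans _ _ (\int[mu]_x ((C * G)%:E * (\1_`]a, b]%classic x)%:E))%E).
  have mk : measurable_fun setT (abse \o (EFin \o kernel)).
    by apply: measurableT_comp => //; exact/measurable_EFinP.
  apply: ge0_le_integral => //.
  - by move=> x _; exact: integral_ge0.
  - by have := @measurable_fun_fubini_tonelli_F _ _ _ _ R mu _ mk; apply => p; exact: abse_ge0.
  - apply: measurable_funeM; apply/measurable_EFinP; exact: measurable_indic.
  move=> x _.
  have step : (\int[mu]_y `|(EFin \o kernel) (x, y)| <=
      \int[mu]_y ((C * \1_`]a, b]%classic x)%:E * (`|g0 y|)%:E))%E.
    apply: ge0_le_integral => //.
    - apply: (measurableT_comp mk); exact: pair1_measurable.
    - by apply: measurable_funeM; apply/measurable_EFinP; apply: measurableT_comp.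
    move=> y _ /=; rewrite -EFinM lee_fin /kernel /= !normrM mulrA.
    apply: ler_pM => //.
    rewrite -[leRHS]mulr1; apply: ler_pM => //.
      have := eC x; rewrite /e0 patchE indicE; case: ifP => _; rewrite ?mulr1//.
      by rewrite normr0 mulr0.
    by rewrite indicE; case: (_ \in _); rewrite ?normr1 ?normr0.
  apply: (le_trans step); rewrite ge0_integralZl_EFin//; last 2 first.
  - by apply/measurable_EFinP; apply: measurableT_comp.
  - by rewrite mulr_ge0// indicE; case: (_ \in _).
  by rewrite EFin_Rintegral// -!EFinM lee_fin -/G mulrAC.
rewrite ge0_integralZl_EFin//; last 2 first.
- apply/measurable_EFinP; exact: measurable_indic.
- by rewrite mulr_ge0//; apply: Rintegral_ge0.
rewrite integral_indic// setIT [X in (_ * X)%E](lebesgue_measure_itv `]a, b]) /=.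
by case: ifP => _; rewrite -?EFinB -EFinM ltry.
Qed.

Let kernel_fst t : (\int[mu]_s (EFin \o kernel) (t, s))%E =
  ((fun t => e' t * \int[mu]_(s in `]a, t]) g s) \_ `]a, b] t)%:E.
Proof.
rewrite /kernel /= patchE /e0 patchE; case: ifPn => [|_]; last first.
  by under eq_integral do rewrite mul0r; rewrite integral0.
rewrite inE /= in_itv /= => /andP[at_ tb].
have sub : `]a, t] `<=` `]a, b].
  by apply: subset_itvl; rewrite bnd_simp.
have gti : mu.-integrable `]a, t] (EFin \o g) by apply: integrableS gi.
under eq_integral do rewrite EFinM.
rewrite integralZl//; last first.
  rewrite (_ : (fun _ => _) = (EFin \o g) \_ `]a, t]).
    by apply/integrable_restrict => //; rewrite setTI.
  apply/funext => s; rewrite restrict_EFin /= /g0 !patchE indicE !mem_setE !in_itv /= andbT subr_ge0.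
  case: (leP s t) => st; rewrite ?mul1r ?mul0r ?andbF// andbT.
  by rewrite (le_trans st tb) andbT.
rewrite EFinM -EFin_Rintegral//; congr (_ * _)%E.
rewrite [RHS]integral_mkcond; apply: eq_integral => s _.
rewrite restrict_EFin /= /g0 !patchE indicE !mem_setE !in_itv /= andbT subr_ge0.
case: (leP s t) => st; rewrite ?mul1r ?mul0r ?andbF// andbT.
by rewrite (le_trans st tb) andbT.
Qed.

Let kernel_snd s : (\int[mu]_t (EFin \o kernel) (t, s))%E =
  ((fun s => (e b - e s) * g s) \_ `]a, b] s)%:E.
Proof.
rewrite /kernel /= patchE /g0 patchE; case: ifPn => [|_]; last first.
  by under eq_integral do rewrite !mulr0; rewrite integral0.
rewrite inE /= in_itv /= => /andP[as_ sb].
have e'i : mu.-integrable `[s, b] (EFin \o e').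
  apply: continuous_compact_integrable; first exact: segment_compact.
  exact: continuous_subspaceT.
rewrite -(Rintegral_derive sb de ce') EFinM -EFin_Rintegral//.
rewrite [X in (X * _)%E]integral_mkcond muleC -integralZl//; last first.
  by apply/integrable_restrict => //; rewrite setTI.
apply: eq_integral => t _.
rewrite restrict_EFin /= /e0 !patchE indicE !mem_setE !in_itv /= andbT subr_ge0.
case: (leP s t) => st; rewrite ?mul1r ?mul0r ?mulr0 ?mule0//=.
by rewrite (lt_le_trans as_ st) /= -EFinM mulrC; case: ifP => _; rewrite ?mulr0.
Qed.

Lemma integrable_by_parts : mu.-integrable `]a, b]
  (EFin \o (fun t => e' t * \int[mu]_(s in `]a, t]) g s)).
Proof.
have : mu.-integrable setT
    (EFin \o ((fun t => e' t * \int[mu]_(s in `]a, t]) g s) \_ `]a, b])).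
  apply: eq_integrable (integrable_fubini_F kernel_integrable) => // t _.
  exact: kernel_fst.
rewrite -[X in mu.-integrable _ X]restrict_EFin.
by move=> /(integrable_restrict _ _ _ _).2; rewrite setTI; apply.
Qed.

Lemma Rintegral_by_parts :
  \int[mu]_(t in `]a, b]) (e' t * \int[mu]_(s in `]a, t]) g s) =
  \int[mu]_(s in `]a, b]) ((e b - e s) * g s).
Proof.
rewrite Rintegral_mkcond [RHS]Rintegral_mkcond /Rintegral; congr fine.
transitivity (\int[mu]_t \int[mu]_s (EFin \o kernel) (t, s))%E.
  by apply: eq_integral => t _; exact/esym/kernel_fst.
rewrite (Fubini kernel_integrable).
by apply: eq_integral => s _; exact: kernel_snd.
Qed.

End ByParts.
End IntegrationByParts.

(** * Complex-valued integrals and square integrable functions *)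

Section ComplexMeasurability.
Context {R : realType} d (T : measurableType d).
Implicit Types (D : set T) (h : T -> R[i]).

Definition cmeasurable D h :=
  measurable_fun D (fun x => cre (h x)) /\ measurable_fun D (fun x => cim (h x)).

Lemma cmeasurable_cst D (c : R[i]) : cmeasurable D (fun=> c).
Proof. by split; exact: measurable_cst. Qed.

Lemma cmeasurable_RtoC D (g : T -> R) : measurable_fun D g ->
  cmeasurable D (fun x => RtoC (g x)).
Proof. by move=> mg; split => //=; exact: measurable_cst. Qed.

Lemma cmeasurableD D h1 h2 : cmeasurable D h1 -> cmeasurable D h2 ->
  cmeasurable D (fun x => h1 x + h2 x).
Proof.
by move=> [a1 b1] [a2 b2]; split; under eq_fun do rewrite ?creD ?cimD;
  exact: measurable_funD.
Qed.

Lemma cmeasurableN D h : cmeasurable D h -> cmeasurable D (fun x => - h x).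
Proof.
by move=> [a1 b1]; split; under eq_fun do rewrite ?creN ?cimN;
  apply: measurableT_comp.
Qed.

Lemma cmeasurableM D h1 h2 : cmeasurable D h1 -> cmeasurable D h2 ->
  cmeasurable D (fun x => h1 x * h2 x).
Proof.
move=> [a1 b1] [a2 b2]; split; under eq_fun do rewrite ?creM ?cimM.
- by apply: measurable_funB; exact: measurable_funM.
- by apply: measurable_funD; exact: measurable_funM.
Qed.

Lemma cmeasurable_sum D n (F : 'I_n -> T -> R[i]) :
  (forall i, cmeasurable D (F i)) -> cmeasurable D (fun x => \sum_i F i x).
Proof.
elim: n F => [|n IH] F mF.
  by under eq_fun do rewrite big_ord0; exact: cmeasurable_cst.
under eq_fun do rewrite big_ord_recr.
by apply: cmeasurableD => //; apply: IH.
Qed.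

Lemma cmeasurable_cexp D h : cmeasurable D h -> cmeasurable D (fun x => cexp (h x)).
Proof.
move=> [a b]; split => /=; apply: measurable_funM.
- exact: measurableT_comp a.
- apply: measurableT_comp b; exact: (continuous_measurable_fun (@continuous_cos R)).
- exact: measurableT_comp a.
- apply: measurableT_comp b; exact: (continuous_measurable_fun (@continuous_sin R)).
Qed.

Lemma cmeasurableS (E D : set T) h : measurable E -> D `<=` E ->
  cmeasurable E h -> cmeasurable D h.
Proof. by move=> mE DE [a b]; split; apply: (measurable_funS mE DE). Qed.

Lemma eq_cmeasurable D h1 h2 : {in D, h1 =1 h2} -> cmeasurable D h1 -> cmeasurable D h2.
Proof.
by move=> h12 [a b]; split; [apply: eq_measurable_fun a|apply: eq_measurable_fun b] => x Dx;
  rewrite h12.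
Qed.

Lemma measurable_norm1 D h : cmeasurable D h -> measurable_fun D (fun x => norm1 (h x)).
Proof.
by move=> [a b]; apply: measurable_funD; apply: measurableT_comp.
Qed.

End ComplexMeasurability.

Section ComplexIntegral.
Context {R : realType}.
Local Notation mu := (@lebesgue_measure R).
Implicit Types (D : set (measurableTypeR R)) (h : R -> R[i]) (c : R[i]).

Lemma cintegrable_dom D h (g : R -> R) : measurable D -> cmeasurable D h ->
  mu.-integrable D (EFin \o g) -> (forall x, D x -> norm1 (h x) <= g x) ->
  cintegrable D h.
Proof.
move=> mD [mr mi] gi hg; split; apply: (le_integrable mD _ _ gi);
  try exact/measurable_EFinP.
- move=> x Dx; rewrite lee_fin; apply: le_trans (ler_norm _).
  by apply: le_trans (hg x Dx); rewrite /norm1 lerDl.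
- move=> x Dx; rewrite lee_fin; apply: le_trans (ler_norm _).
  by apply: le_trans (hg x Dx); rewrite /norm1 lerDr.
Qed.

Lemma cintegrable_cmeasurable D h : cintegrable D h -> cmeasurable D h.
Proof.
by move=> [/integrableP[/measurable_EFinP a _] /integrableP[/measurable_EFinP b _]].
Qed.

Lemma cintegrableS (E D : set (measurableTypeR R)) h : measurable E -> measurable D -> D `<=` E ->
  cintegrable E h -> cintegrable D h.
Proof. by move=> mE mD DE [a b]; split; apply: (integrableS mE mD DE). Qed.

Lemma eq_cintegrable D h1 h2 : measurable D -> {in D, h1 =1 h2} ->
  cintegrable D h1 -> cintegrable D h2.
Proof.
by move=> mD h12 [a b]; split; [apply: eq_integrable a|apply: eq_integrable b] => // x Dx;
  rewrite h12.
Qed.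

Lemma cintegrableD D h1 h2 : measurable D -> cintegrable D h1 -> cintegrable D h2 ->
  cintegrable D (fun x => h1 x + h2 x).
Proof.
move=> mD [a1 b1] [a2 b2]; split; under eq_fun do rewrite ?creD ?cimD EFinD.
- exact: integrableD.
- exact: integrableD.
Qed.

Lemma cintegrableM D h1 h2 : measurable D ->
  mu.-integrable D (EFin \o (fun x => cre (h1 x) * cre (h2 x))) ->
  mu.-integrable D (EFin \o (fun x => cim (h1 x) * cim (h2 x))) ->
  mu.-integrable D (EFin \o (fun x => cre (h1 x) * cim (h2 x))) ->
  mu.-integrable D (EFin \o (fun x => cim (h1 x) * cre (h2 x))) ->
  cintegrable D (fun x => h1 x * h2 x).
Proof.
move=> mD irr iii iri iir; split; under eq_fun do rewrite ?creM ?cimM ?EFinB ?EFinD.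
- exact: integrableB.
- exact: integrableD.
Qed.

Lemma cintegrableZ D c h : measurable D -> cintegrable D h ->
  cintegrable D (fun x => c * h x).
Proof.
move=> mD [a b].
have az r : mu.-integrable D (EFin \o (fun x => r * cre (h x))).
  by have := integrableZl mD r a.
have bz r : mu.-integrable D (EFin \o (fun x => r * cim (h x))).
  by have := integrableZl mD r b.
by apply: cintegrableM; [|exact: az|exact: bz|exact: bz|exact: az].
Qed.

Lemma cintegrableN D h : measurable D -> cintegrable D h ->
  cintegrable D (fun x => - h x).
Proof.
move=> mD hi; apply: eq_cintegrable (cintegrableZ (-1) mD hi) => // x _.
by rewrite mulN1r.
Qed.

Lemma eq_cint D h1 h2 : {in D, h1 =1 h2} -> cint D h1 = cint D h2.
Proof. by move=> h12; congr Complex; apply: eq_Rintegral => x Dx; rewrite h12. Qed.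

Lemma cintD D h1 h2 : measurable D -> cintegrable D h1 -> cintegrable D h2 ->
  cint D (fun x => h1 x + h2 x) = cint D h1 + cint D h2.
Proof.
move=> mD [a1 b1] [a2 b2]; apply: complex_ext; rewrite ?creD ?cimD /=.
- by under eq_Rintegral do rewrite creD; rewrite RintegralD.
- by under eq_Rintegral do rewrite cimD; rewrite RintegralD.
Qed.

Lemma cintZ D c h : measurable D -> cintegrable D h ->
  cint D (fun x => c * h x) = c * cint D h.
Proof.
move=> mD [a b].
have az r : mu.-integrable D (EFin \o (fun x => r * cre (h x))).
  by have := integrableZl mD r a.
have bz r : mu.-integrable D (EFin \o (fun x => r * cim (h x))).
  by have := integrableZl mD r b.
apply: complex_ext; rewrite ?creM ?cimM /=.
- under eq_Rintegral do rewrite creM.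
  by rewrite RintegralB ?RintegralZl.
- under eq_Rintegral do rewrite cimM.
  by rewrite RintegralD ?RintegralZl.
Qed.

Lemma cintN D h : measurable D -> cintegrable D h ->
  cint D (fun x => - h x) = - cint D h.
Proof.
move=> mD hi; rewrite -mulN1r -cintZ//.
by apply: eq_cint => x _; rewrite mulN1r.
Qed.

Lemma cint_setU (A B : set (measurableTypeR R)) h : measurable A -> measurable B ->
  cintegrable (A `|` B) h -> [disjoint A & B] ->
  cint (A `|` B) h = cint A h + cint B h.
Proof.
move=> mA mB [a b] AB; apply: complex_ext; rewrite ?creD ?cimD /=;
  by rewrite Rintegral_setU.
Qed.

Lemma cint_itv_bndo_bndc (a : itv_bound R) (r : R) h :
  cintegrable [set` Interval a (BLeft r)] h ->
  cint [set` Interval a (BLeft r)] h = cint [set` Interval a (BRight r)] h.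
Proof. by move=> [i1 i2]; congr Complex; apply: Rintegral_itv_bndo_bndc. Qed.

(** Data on [R_-] live on intervals that are open at [0], whereas [primitive] integrates over
    intervals closed on the right; a single point is negligible. *)
Lemma cintegrable_itv_bndo_bndc (a r : R) h :
  cintegrable `]a, r[ h -> cintegrable `]a, r] h.
Proof.
have ext (f : R -> R) : mu.-integrable `]a, r[ (EFin \o f) ->
    mu.-integrable `]a, r] (EFin \o f).
  move=> /integrableP[mf fi].
  have mf' : measurable_fun `]a, r] (EFin \o f).
    by apply/measurable_EFinP/measurable_fun_itv_bndo_bndcP; exact/measurable_EFinP.
  apply/integrableP; split => //.
  by rewrite -integral_itv_bndo_bndc//; exact: measurableT_comp.
by move=> [i1 i2]; split; apply: ext.
Qed.

Lemma cint_itv_obnd_cbnd (r : R) (b : itv_bound R) h :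
  cintegrable [set` Interval (BRight r) b] h ->
  cint [set` Interval (BRight r) b] h = cint [set` Interval (BLeft r) b] h.
Proof. by move=> [i1 i2]; congr Complex; apply: Rintegral_itv_obnd_cbnd. Qed.

Lemma ae_eq_cint D h1 h2 : measurable D -> cmeasurable D h1 -> cmeasurable D h2 ->
  {ae mu, forall x, D x -> h1 x = h2 x} -> cint D h1 = cint D h2.
Proof.
move=> mD [a1 b1] [a2 b2] h12; congr Complex; congr fine; apply: ae_eq_integral => //;
  try exact/measurable_EFinP.
- by move: h12; apply: filterS => x /[apply] ->.
- by move: h12; apply: filterS => x /[apply] ->.
Qed.

Lemma cint_set0 h : cint set0 h = 0.
Proof. by apply: complex_ext => /=; rewrite Rintegral_set0. Qed.

End ComplexIntegral.

(** * Square integrable functions, componentwise *)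

Section SquareIntegrable.
Context {R : realType}.
Local Notation mu := (@lebesgue_measure R).
Implicit Types (D : set (measurableTypeR R)) (h : R -> R[i]) (c : R[i]).

(** Stated with [norm1] because it is subadditive and submultiplicative. By [norm1_sqr_le] and
    [le_norm1_sqr] its square is comparable to the squared modulus, and [L2onP] converts between the
    two. *)
Definition cL2 D h :=
  cmeasurable D h /\ mu.-integrable D (EFin \o (fun x => norm1 (h x) ^+ 2)).

Lemma cL2_dom D h (g : R -> R) : measurable D -> cmeasurable D h ->
  mu.-integrable D (EFin \o g) -> (forall x, D x -> norm1 (h x) ^+ 2 <= g x) ->
  cL2 D h.
Proof.
move=> mD mh gi hg; split=> //; apply: le_integrable gi => //.
  by apply/measurable_EFinP; apply: measurable_funX; exact: measurable_norm1.
move=> x Dx; rewrite lee_fin ger0_norm ?sqr_ge0//.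
by apply: le_trans (hg x Dx) (ler_norm _).
Qed.

Lemma cL2D D h1 h2 : measurable D -> cL2 D h1 -> cL2 D h2 ->
  cL2 D (fun x => h1 x + h2 x).
Proof.
move=> mD [m1 i1] [m2 i2].
have := integrableD mD (integrableZl mD 2 i1) (integrableZl mD 2 i2).
move=> /(cL2_dom (g := fun x => 2 * norm1 (h1 x) ^+ 2 + 2 * norm1 (h2 x) ^+ 2)).
apply => //; first exact: cmeasurableD.
move=> x _; have := norm1D (h1 x) (h2 x); have := norm1_ge0 (h1 x + h2 x).
have := sqr_ge0 (norm1 (h1 x) - norm1 (h2 x)); nra.
Qed.

Lemma cL2Z D c h : measurable D -> cL2 D h -> cL2 D (fun x => c * h x).
Proof.
move=> mD [m1 i1].
have := integrableZl mD (norm1 c ^+ 2) i1.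
move=> /(cL2_dom (g := fun x => norm1 c ^+ 2 * norm1 (h x) ^+ 2)).
apply => //; first exact/cmeasurableM.
move=> x _; rewrite -exprMn ler_sqr ?nnegrE ?mulr_ge0 ?norm1_ge0//.
exact: norm1M.
Qed.

Lemma cL2S (E D : set (measurableTypeR R)) h : measurable E -> measurable D -> D `<=` E ->
  cL2 E h -> cL2 D h.
Proof.
move=> mE mD DE [m1 i1]; split; first exact: cmeasurableS m1.
exact: integrableS i1.
Qed.

Lemma eq_cL2 D h1 h2 : measurable D -> {in D, h1 =1 h2} -> cL2 D h1 -> cL2 D h2.
Proof.
move=> mD h12 [m1 i1]; split; first exact: eq_cmeasurable m1.
by apply: eq_integrable i1 => // x Dx /=; rewrite h12.
Qed.

(** On a bounded set the constant 1 is integrable, and [norm1 h <= 1 + norm1 h ^+ 2]. *)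
Lemma cL2_cintegrable (a b : R) D h : measurable D -> D `<=` `[a, b]%classic ->
  cL2 D h -> cintegrable D h.
Proof.
move=> mD Dab [mh hi].
have i2 : mu.-integrable `[a, b] (EFin \o cst 1).
  apply: continuous_compact_integrable; first exact: segment_compact.
  by apply: continuous_subspaceT => x; exact: cvg_cst.
have i1 : mu.-integrable D (EFin \o cst 1) by apply: integrableS i2.
apply: (cintegrable_dom mD mh (integrableD mD i1 hi)) => // x _ /=.
have := sqr_ge0 (norm1 (h x) - 1); have := norm1_ge0 (h x); nra.
Qed.

Lemma L2onP D (F : R -> 'cV[R[i]]_2) : measurable D ->
  L2on D F <-> forall i, cL2 D (fun x => F x i 0).
Proof.
move=> mD; split=> [[mF iF] i|cF].
  apply: cL2_dom (integrableZl mD 2 iF) _ => //; first by have [] := mF i.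
  move=> x _ /=; apply: (le_trans (norm1_sqr_le _)).
  rewrite ler_pM2l// /sqnorm (bigD1 i)//= lerDl sumr_ge0// => j _.
  by rewrite addr_ge0 ?sqr_ge0.
split=> [i|]; first by have [[]] := cF i.
under eq_fun do rewrite /sqnorm -sumEFin.
apply: integrable_sum => // i _.
have [[a b] ni] := cF i; apply: le_integrable ni => //.
  by apply/measurable_EFinP; apply: measurable_funD; exact: measurable_funX.
move=> x _ /=; rewrite lee_fin ger0_norm ?addr_ge0 ?sqr_ge0// ger0_norm ?sqr_ge0//.
exact: le_norm1_sqr.
Qed.

End SquareIntegrable.

(** * Complex primitives and exponentials *)

Section Primitives.
Context {R : realType}.
Local Notation mu := (@lebesgue_measure R).
Implicit Types (a b t : R) (c lam : R[i]) (g G : R -> R[i]).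

Definition cexpR lam t : R[i] := cexp (lam * RtoC t).

Lemma cexpRD lam s t : cexpR lam (s + t) = cexpR lam s * cexpR lam t.
Proof. by rewrite /cexpR RtoCD mulrDr cexpD. Qed.

Lemma cexpR0 lam : cexpR lam 0 = 1.
Proof. by rewrite /cexpR RtoC0 mulr0 cexp0. Qed.

Lemma cexpRNM lam t : cexpR (- lam) t * cexpR lam t = 1.
Proof. by rewrite /cexpR mulNr cexpNM. Qed.

Lemma norm1_cexpR lam t : norm1 (cexpR lam t) <= 2 * expR (cre lam * t).
Proof. by rewrite -creMR; exact: norm1_cexp. Qed.

Lemma is_derive_cre_cexpR lam t :
  is_derive t (1 : R) (fun t => cre (cexpR lam t)) (cre (lam * cexpR lam t)).
Proof.
rewrite /cexpR creM /=; under eq_fun do rewrite creMR cimMR.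
apply: is_derive_eq; rewrite creMR cimMR /GRing.scale /= !mulr1.
by rewrite ?mul0r ?add0r ?addr0 ?mulr0; ring.
Qed.

Lemma is_derive_cim_cexpR lam t :
  is_derive t (1 : R) (fun t => cim (cexpR lam t)) (cim (lam * cexpR lam t)).
Proof.
rewrite /cexpR cimM /=; under eq_fun do rewrite creMR cimMR.
apply: is_derive_eq; rewrite creMR cimMR /GRing.scale /= !mulr1.
by rewrite ?mul0r ?add0r ?addr0 ?mulr0; ring.
Qed.

Lemma continuous_cre_cexpR lam : continuous (fun t => cre (lam * cexpR lam t)).
Proof.
have cr : continuous (fun t => cre (cexpR lam t)).
  move=> t; apply: differentiable_continuous; apply/derivable1_diffP.
  by have [] := is_derive_cre_cexpR lam t.
have ci : continuous (fun t => cim (cexpR lam t)).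
  move=> t; apply: differentiable_continuous; apply/derivable1_diffP.
  by have [] := is_derive_cim_cexpR lam t.
under eq_fun do rewrite creM.
move=> t; apply: cvgB; apply: cvgM; [exact: cvg_cst|exact: cr|exact: cvg_cst|exact: ci].
Qed.

Lemma continuous_cim_cexpR lam : continuous (fun t => cim (lam * cexpR lam t)).
Proof.
have cr : continuous (fun t => cre (cexpR lam t)).
  move=> t; apply: differentiable_continuous; apply/derivable1_diffP.
  by have [] := is_derive_cre_cexpR lam t.
have ci : continuous (fun t => cim (cexpR lam t)).
  move=> t; apply: differentiable_continuous; apply/derivable1_diffP.
  by have [] := is_derive_cim_cexpR lam t.
under eq_fun do rewrite cimM.
move=> t; apply: cvgD; apply: cvgM; [exact: cvg_cst|exact: ci|exact: cvg_cst|exact: cr].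
Qed.

Lemma continuous_cexpR lam :
  continuous (fun t => cre (cexpR lam t)) /\ continuous (fun t => cim (cexpR lam t)).
Proof.
split=> t; apply: differentiable_continuous; apply/derivable1_diffP.
- by have [] := is_derive_cre_cexpR lam t.
- by have [] := is_derive_cim_cexpR lam t.
Qed.

Lemma cint_cexpR lam a b : a <= b ->
  cintegrable `]a, b] (fun t => lam * cexpR lam t) /\
  cint `]a, b] (fun t => lam * cexpR lam t) = cexpR lam b - cexpR lam a.
Proof.
move=> ab; have ir : mu.-integrable `]a, b] (EFin \o (fun t => cre (lam * cexpR lam t))).
  apply: continuous_integrable_itv; exact: continuous_cre_cexpR.
have ii : mu.-integrable `]a, b] (EFin \o (fun t => cim (lam * cexpR lam t))).
  apply: continuous_integrable_itv; exact: continuous_cim_cexpR.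
split=> //; apply: complex_ext; rewrite ?creD ?cimD ?creN ?cimN /=.
- rewrite -(Rintegral_derive ab (is_derive_cre_cexpR lam))//.
    exact: Rintegral_itv_obnd_cbnd.
  exact: continuous_cre_cexpR.
- rewrite -(Rintegral_derive ab (is_derive_cim_cexpR lam))//.
    exact: Rintegral_itv_obnd_cbnd.
  exact: continuous_cim_cexpR.
Qed.

Lemma cintegrable_cexpRM lam a b g : cintegrable `]a, b] g ->
  cintegrable `]a, b] (fun t => cexpR lam t * g t).
Proof.
move=> [gr gi]; have [cr ci] := continuous_cexpR lam.
by apply: cintegrableM => //; exact: integrable_continuousM.
Qed.

(** Four real integrations by parts, one for each pairing of a real or imaginary part of the
    exponential with one of [g]. *)
Lemma cint_by_parts lam a b g : cintegrable `]a, b] g ->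
  cintegrable `]a, b] (fun t => lam * cexpR lam t * cint `]a, t] g) /\
  cint `]a, b] (fun t => lam * cexpR lam t * cint `]a, t] g) =
  cint `]a, b] (fun s => (cexpR lam b - cexpR lam s) * g s).
Proof.
move=> [gr gi].
have dr := is_derive_cre_cexpR lam; have di := is_derive_cim_cexpR lam.
have cr := @continuous_cre_cexpR lam; have ci := @continuous_cim_cexpR lam.
have irr := integrable_by_parts cr gr; have iri := integrable_by_parts cr gi.
have iir := integrable_by_parts ci gr; have iii := integrable_by_parts ci gi.
have [er ei] := continuous_cexpR lam.
have sub (f : R -> R) (k : R) : continuous f -> continuous (fun t => k - f t).
  by move=> cf t; apply: cvgB; [exact: cvg_cst|exact: cf].
have jrr := integrable_continuousM (sub _ (cre (cexpR lam b)) er) gr.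
have jri := integrable_continuousM (sub _ (cre (cexpR lam b)) er) gi.
have jir := integrable_continuousM (sub _ (cim (cexpR lam b)) ei) gr.
have jii := integrable_continuousM (sub _ (cim (cexpR lam b)) ei) gi.
split; first exact: cintegrableM.
apply: complex_ext => /=.
- under eq_Rintegral do rewrite creM /=.
  under [RHS]eq_Rintegral do rewrite creM creD cimD creN cimN.
  rewrite RintegralB// (Rintegral_by_parts dr cr gr).
  by rewrite (Rintegral_by_parts di ci gi) RintegralB.
- under eq_Rintegral do rewrite cimM /=.
  under [RHS]eq_Rintegral do rewrite cimM creD cimD creN cimN.
  rewrite RintegralD// (Rintegral_by_parts dr cr gi).
  by rewrite (Rintegral_by_parts di ci gr) RintegralD.
Qed.

(** Absolute continuity of [G] on [[a, b]] with derivative [g], in integral form. Only the class of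
    [g] up to null sets matters, while [G] is prescribed at every point of [[a, b]], the left
    endpoint included. *)
Definition primitive a b G g :=
  cintegrable `]a, b] g /\ forall t, a <= t <= b -> G t = G a + cint `]a, t] g.

Lemma primitiveS a b b' G g : b' <= b -> primitive a b G g -> primitive a b' G g.
Proof.
move=> bb' [gi GE]; split.
  by apply: cintegrableS gi => //; apply: subset_itvl; rewrite bnd_simp.
by move=> t /andP[at_ tb]; apply: GE; rewrite at_ (le_trans tb).
Qed.

Lemma primitiveD a b G1 G2 g1 g2 : primitive a b G1 g1 -> primitive a b G2 g2 ->
  primitive a b (fun t => G1 t + G2 t) (fun t => g1 t + g2 t).
Proof.
move=> [i1 E1] [i2 E2]; split; first exact: cintegrableD.
move=> t atb; have /andP[at_ tb] := atb.
have sub : `]a, t] `<=` `]a, b] by apply: subset_itvl; rewrite bnd_simp.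
rewrite cintD//; try exact: cintegrableS sub _.
by rewrite E1// E2// addrACA.
Qed.

Lemma primitiveZ a b c G g : primitive a b G g ->
  primitive a b (fun t => c * G t) (fun t => c * g t).
Proof.
move=> [i1 E1]; split; first exact: cintegrableZ.
move=> t atb; have /andP[at_ tb] := atb.
have sub : `]a, t] `<=` `]a, b] by apply: subset_itvl; rewrite bnd_simp.
by rewrite cintZ//; [rewrite E1// mulrDr|exact: cintegrableS sub _].
Qed.

Lemma primitive_addc a b c G g : primitive a b G g ->
  primitive a b (fun t => G t + c) g.
Proof. by move=> [i1 E1]; split=> // t atb; rewrite E1// addrAC. Qed.

Lemma eq_primitive a b G1 G2 g1 g2 : a <= b -> (forall t, a <= t <= b -> G1 t = G2 t) ->
  (forall t, a < t <= b -> g1 t = g2 t) ->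
  primitive a b G1 g1 -> primitive a b G2 g2.
Proof.
move=> ab G12 g12 [i1 E1]; split.
  by apply: eq_cintegrable i1 => // t; rewrite inE /= in_itv /= => /g12.
move=> t atb; have /andP[at_ tb] := atb.
rewrite -G12// -G12 ?lexx// E1//; congr (_ + _); apply: eq_cint => s.
by rewrite inE /= in_itv /= => /andP[as_ st]; rewrite g12// as_ (le_trans st).
Qed.

(** The product rule. Write [G] as [G a] plus the integral of [g]: the constant part is the
    fundamental theorem for the exponential, the other part is [cint_by_parts]. *)
Lemma primitive_cexpRM a b lam G g : a <= b -> primitive a b G g ->
  primitive a b (fun t => cexpR lam t * G t)
    (fun t => cexpR lam t * (lam * G t + g t)).
Proof.
move=> ab pG.
have rule t : a <= t -> primitive a t G g ->
    cintegrable `]a, t] (fun s => cexpR lam s * (lam * G s + g s)) /\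
    cexpR lam t * G t = cexpR lam a * G a +
      cint `]a, t] (fun s => cexpR lam s * (lam * G s + g s)).
  move=> at_ [gi GE]; have [i1 E1] := cint_by_parts lam gi.
  have i2 := cintegrable_cexpRM lam gi.
  have [i0 E0] := cint_cexpR lam at_.
  have iG0 := cintegrableZ (G a) (measurable_itv `]a, t]) i0.
  have dec : {in `]a, t]%classic,
      (fun s => G a * (lam * cexpR lam s) + (lam * cexpR lam s * cint `]a, s] g +
        cexpR lam s * g s)) =1
      (fun s => cexpR lam s * (lam * G s + g s))}.
    move=> s; rewrite inE /= in_itv /= => /andP[as_ st].
    by rewrite (GE s) ?(ltW as_)//; ring.
  split.
    by apply: (eq_cintegrable _ dec) => //; apply: cintegrableD => //; exact: cintegrableD.
  rewrite -(eq_cint dec) cintD//; last exact: cintegrableD.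
  rewrite cintD// cintZ// E0 E1.
  (* Splits the outcome of the integration by parts: the term with [cexpR lam t] restores
     [cexpR lam t * (G t - G a)], and the other one cancels the integral of [cexpR lam s * g s]. *)
  have dec2 : {in `]a, t]%classic,
      (fun s => cexpR lam t * g s + - (cexpR lam s * g s)) =1
      (fun s => (cexpR lam t - cexpR lam s) * g s)}.
    by move=> s _; ring.
  rewrite -(eq_cint dec2) cintD//; last 2 first.
  - exact: cintegrableZ.
  - exact: cintegrableN.
  rewrite cintZ// cintN// (GE t) ?at_ ?lexx//; ring.
split; first by have [] := rule b ab pG.
by move=> t /andP[at_ tb]; have [] := rule t at_ (primitiveS tb pG).
Qed.

End Primitives.

(** * Boundedness of the kernel operator *)

Section KernelOperator.
Context {R : realType}.
Local Notation mu := (@lebesgue_measure R).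
Implicit Types (x y : R) (f : R -> 'cV[R[i]]_2).

Variables (K : R -> R -> 'M[R[i]]_2) (C kap : R).
Hypothesis kap0 : 0 < kap.
Hypothesis K_measurable :
  forall i j, cmeasurable setT (fun p : R * R => K p.1 p.2 i j).
Hypothesis K_bound :
  forall x y i j, norm1 (K x y i j) <= C * expR (- kap * `|x - y|).

Let phi f y := \sum_(j < 2) norm1 (f y j 0).

Let phi_measurable f : L2on setT f -> measurable_fun setT (phi f).
Proof.
move=> /(L2onP _ measurableT) fL2.
by apply: measurable_sum => j; apply: measurable_norm1; have [] := fL2 j.
Qed.

(** A factor 2 from [(a + b)^2 <= 2 (a^2 + b^2)] and a factor 2 from comparing [norm1] with the
    modulus. *)
Let phi_sqr_le f y : phi f y ^+ 2 <= 4 * sqnorm (f y).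
Proof.
rewrite /phi /sqnorm !big_ord_recl !big_ord0 !addr0.
set a := norm1 _; set b := norm1 _.
have := norm1_sqr_le (f y ord0 0); have := norm1_sqr_le (f y (lift ord0 ord0) 0).
rewrite -/a -/b; have := sqr_ge0 (a - b); nra.
Qed.

Let phi_integrable f : L2on setT f -> mu.-integrable setT (fun y => (phi f y ^+ 2)%:E).
Proof.
move=> fL2; have [_ fi] := fL2.
apply: le_integrable (integrableZl measurableT 4 fi) => //.
  by apply/measurable_EFinP; apply: measurable_funX; exact: phi_measurable.
move=> y _; rewrite lee_fin ger0_norm ?sqr_ge0// (le_trans (phi_sqr_le f y))//.
exact: ler_norm.
Qed.

Let h f (i : 'I_2) (p : R * R) := (K p.1 p.2 *m f p.2) i 0.

Let h_measurable f i : L2on setT f -> cmeasurable setT (h f i).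
Proof.
move=> /(L2onP _ measurableT) fL2; rewrite /h.
apply: (@eq_cmeasurable _ _ _ _ (fun p => \sum_j K p.1 p.2 i j * f p.2 j 0)).
  by move=> p _; rewrite mxE.
apply: cmeasurable_sum => j; apply: cmeasurableM => //.
have [[mr mi] _] := fL2 j; split.
- exact: (measurableT_comp mr measurable_snd).
- exact: (measurableT_comp mi measurable_snd).
Qed.

Let h_bound f i x y :
  norm1 (h f i (x, y)) <= C * (expR (- kap * `|x - y|) * phi f y).
Proof.
rewrite /h /= mxE; apply: (le_trans (norm1_sum _)).
rewrite mulrA /phi mulr_sumr; apply: ler_sum => j _.
apply: (le_trans (norm1M _ _)); apply: ler_wpM2r; first exact: norm1_ge0.
exact: K_bound.
Qed.

Let re_bound f i x y :
  `|cre (h f i (x, y))| <= C * (expR (- kap * `|x - y|) * phi f y).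
Proof. by apply: le_trans (h_bound f i x y); rewrite /norm1 lerDl. Qed.

Let im_bound f i x y :
  `|cim (h f i (x, y))| <= C * (expR (- kap * `|x - y|) * phi f y).
Proof. by apply: le_trans (h_bound f i x y); rewrite /norm1 lerDr. Qed.

Lemma vintegrable_kernel f x : L2on setT f -> vintegrable setT (fun y => K x y *m f y).
Proof.
move=> fL2 i; have [mr mi] := h_measurable i fL2.
have mp := phi_measurable fL2; have ip := phi_integrable fL2.
split.
- by have := integrable_kernel kap0 mp ip mr (re_bound f i) x.
- by have := integrable_kernel kap0 mp ip mi (im_bound f i) x.
Qed.

Lemma intop_sqr_integrable f (i : 'I_2) : L2on setT f ->
  mu.-integrable setT (EFin \o (fun x => cre (intop K f x i 0) ^+ 2)) /\
  mu.-integrable setT (EFin \o (fun x => cim (intop K f x i 0) ^+ 2)).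
Proof.
move=> fL2; have [mr mi] := h_measurable i fL2.
have mp := phi_measurable fL2; have ip := phi_integrable fL2.
have ir := integrable_sqr_kernel kap0 mp ip mr (re_bound f i).
have ii := integrable_sqr_kernel kap0 mp ip mi (im_bound f i).
by split; [apply: eq_integrable ir|apply: eq_integrable ii] => // x _; rewrite /= mxE.
Qed.

Lemma intop_measurable f (i : 'I_2) : L2on setT f ->
  cmeasurable setT (fun x => intop K f x i 0).
Proof.
move=> fL2; have [mr mi] := h_measurable i fL2.
split.
- by under eq_fun do rewrite mxE /=; have := measurable_Rintegral mr.
- by under eq_fun do rewrite mxE /=; have := measurable_Rintegral mi.
Qed.

Lemma intop_L2on f : L2on setT f -> L2on setT (intop K f).
Proof.
move=> fL2; split=> [i|]; first exact: intop_measurable.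
under eq_fun do rewrite /sqnorm -sumEFin.
apply: integrable_sum => // i _; have [ir ii] := intop_sqr_integrable i fL2.
by under eq_fun do rewrite EFinD; exact: integrableD.
Qed.

(** The constant 16 is 4 from [phi_sqr_le] times 4 applications of the scalar Schur bound, to the
    real and imaginary parts of both components. *)
Lemma intop_L2sq f : L2on setT f ->
  L2sq (intop K f) <= 16 * (C * (2 / kap)) ^+ 2 * L2sq f.
Proof.
move=> fL2; have mp := phi_measurable fL2; have ip := phi_integrable fL2.
pose S := \int[mu]_y (phi f y ^+ 2).
have S4 : S <= 4 * L2sq f.
  have [_ fi] := fL2; rewrite /L2sq -RintegralZl//.
  apply: le_Rintegral => //.
  by have := integrableZl measurableT 4 fi.
have one i : \int[mu]_x (cre (intop K f x i 0) ^+ 2) <= (C * (2 / kap)) ^+ 2 * S /\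
             \int[mu]_x (cim (intop K f x i 0) ^+ 2) <= (C * (2 / kap)) ^+ 2 * S.
  have [mr mi] := h_measurable i fL2.
  have [ir ii] := intop_sqr_integrable i fL2.
  rewrite -!lee_fin EFinM -!EFin_Rintegral//; split.
  - under eq_integral do rewrite mxE /=.
    exact: (integral_sqr_kernel kap0 mp ip mr (re_bound f i)).
  - under eq_integral do rewrite mxE /=.
    exact: (integral_sqr_kernel kap0 mp ip mi (im_bound f i)).
have -> : L2sq (intop K f) = \sum_(i < 2)
    (\int[mu]_x (cre (intop K f x i 0) ^+ 2) + \int[mu]_x (cim (intop K f x i 0) ^+ 2)).
  have iD i : mu.-integrable setT (EFin \o
      (fun x => cre (intop K f x i 0) ^+ 2 + cim (intop K f x i 0) ^+ 2)).
    have [ir ii] := intop_sqr_integrable i fL2.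
    by have := integrableD measurableT ir ii.
  rewrite /L2sq /sqnorm !big_ord_recl big_ord0 addr0.
  under eq_Rintegral do rewrite !big_ord_recl big_ord0 addr0.
  have i0 := iD ord0; have i1 := iD (lift ord0 ord0).
  have [a0 b0] := intop_sqr_integrable ord0 fL2.
  have [a1 b1] := intop_sqr_integrable (lift ord0 ord0) fL2.
  by rewrite RintegralD// RintegralD// RintegralD.
rewrite !big_ord_recl big_ord0 addr0.
have [a1 b1] := one ord0; have [a2 b2] := one (lift ord0 ord0).
have := ler_wpM2l (sqr_ge0 (C * (2 / kap))) S4; lra.
Qed.

End KernelOperator.

(** * Exponential bounds and measurability of the resolvent kernels *)

Section ResolventKernel.
Context {R : realType}.

Lemma measurable_sgr : measurable_fun setT (Num.sg : R -> R).
Proof.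
rewrite (_ : Num.sg = fun r => \1_(`]0, +oo[%classic) r - \1_(`]-oo, 0[%classic) r).
  by apply: measurable_funB; exact: measurable_indic.
apply/funext => r; rewrite !indicE !mem_setE !in_itv /= andbT.
case: (ltgtP r 0) => [r0|r0|->] /=.
- by rewrite ltr0_sg// sub0r.
- by rewrite gtr0_sg// subr0.
- by rewrite sgr0 subr0.
Qed.

Implicit Types (x y kap : R).

Let mxBE (M N : 'M[R[i]]_2) i j : (M - N) i j = M i j - N i j.
Proof. by rewrite !mxE. Qed.

Let mx_bounded (M : 'M[R[i]]_2) (c : R) := forall i j, norm1 (M i j) <= c.

Let mx_boundedM (M N : 'M[R[i]]_2) (c d : R) :
  mx_bounded M c -> mx_bounded N d -> mx_bounded (M *m N) (2 * (c * d)).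
Proof.
move=> Mc Nd i j; rewrite mxE; apply: (le_trans (norm1_sum _)).
have e k : norm1 (M i k * N k j) <= c * d.
  by apply: (le_trans (norm1M _ _)); apply: ler_pM; rewrite ?norm1_ge0.
rewrite !big_ord_recl big_ord0 addr0.
have := e ord0; have := e (lift ord0 ord0); lra.
Qed.

Let mx_bounded_exists (M : 'M[R[i]]_2) : exists2 c, 0 <= c & mx_bounded M c.
Proof.
exists (\sum_i \sum_j norm1 (M i j)).
  by apply: sumr_ge0 => i _; apply: sumr_ge0 => j _; exact: norm1_ge0.
move=> i j; rewrite (bigD1 i)//= (bigD1 j)//= -addrA lerDl addr_ge0//.
  by apply: sumr_ge0 => l _; exact: norm1_ge0.
by apply: sumr_ge0 => k _; apply: sumr_ge0 => l _; exact: norm1_ge0.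
Qed.

Variables (m : R) (A : 'M[R[i]]_2) (z : R[i]).
Local Notation kap := (cim (kz m z)).
Hypothesis kap0 : 0 < kap.

Lemma cre_iCM (w : R[i]) : cre (iC * w) = - cim w.
Proof. by rewrite creM /= mul0r mul1r sub0r. Qed.

Lemma Rz_bound : exists2 c, 0 <= c &
  forall x y, mx_bounded (Rz m z x y) (c * expR (- kap * `|x - y|)).
Proof.
have [c c0 cZ] := mx_bounded_exists (Zmat m z).
(* The factor 2 is the loss of [norm1] on an exponential in [norm1_cexp]; [c] bounds the entries of
   [Z] and 1 those of [sgn (x - y) sigma1]. *)
exists (norm1 (iC / 2%:R : R[i]) * 2 * (c + 1)).
  by rewrite !mulr_ge0 ?norm1_ge0 ?addr_ge0.
move=> x y i j; rewrite /Rz !mxE.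
apply: (le_trans (norm1M _ _)).
have -> : norm1 (iC / 2%:R : R[i]) * 2 * (c + 1) * expR (- kap * `|x - y|) =
  norm1 (iC / 2%:R : R[i]) * (2 * expR (- kap * `|x - y|)) * (c + 1) by ring.
apply: ler_pM; rewrite ?norm1_ge0//.
  apply: (le_trans (norm1M _ _)); apply: ler_wpM2l; first exact: norm1_ge0.
  by have := norm1_cexp (iC * kz m z * RtoC `|x - y|); rewrite creMR cre_iCM.
have := cZ i j; rewrite !mxE => cZ'.
apply: (le_trans (norm1D _ _)); apply: lerD => //.
apply: (le_trans (norm1M _ _)); rewrite -[leRHS]mulr1.
apply: ler_pM; rewrite ?norm1_ge0//.
  by rewrite /norm1 /= normr0 addr0 normr_sg; case: (_ == _).
by case: ifP => _; rewrite /norm1 /= ?normr0 ?normr1 ?addr0.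
Qed.

(** The correction term decays like [exp (- kap |x|) exp (- kap |y|)], which the triangle inequality
    bounds by [exp (- kap |x - y|)]. The 8 collects one factor 2 for each of the three products of 2
    by 2 matrices. *)
Lemma RAz_bound : exists2 c, 0 <= c &
  forall x y i j, norm1 (RAz m A z x y i j) <= c * expR (- kap * `|x - y|).
Proof.
have [c c0 cR] := Rz_bound.
set B := invmx (sigma0 + (iC / 2%:R) *: (A *m Zmat m z)).
have [b b0 bB] := mx_bounded_exists B; have [a a0 aA] := mx_bounded_exists A.
exists (c + 8 * (c * b * a * c)).
  by rewrite addr_ge0// !mulr_ge0.
move=> x y i j; rewrite /RAz -/B mxBE.
apply: (le_trans (norm1D _ _)); rewrite norm1N mulrDl; apply: lerD; first exact: cR.
have := mx_boundedM (mx_boundedM (mx_boundedM (cR x 0) bB) aA) (cR 0 y) i j.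
move=> /le_trans; apply; rewrite subr0 sub0r normrN.
have -> : 2 * (2 * (2 * (c * expR (- kap * `|x|) * b) * a) * (c * expR (- kap * `|y|))) =
  8 * (c * b * a * c) * (expR (- kap * `|x|) * expR (- kap * `|y|)) by ring.
apply: ler_wpM2l; first by rewrite !mulr_ge0.
rewrite -expRD ler_expR -mulrDr !mulNr lerN2 ler_pM2l//.
exact: ler_normB.
Qed.

Lemma Rz_measurable d (T : measurableType d) (X Y : T -> R) (i j : 'I_2) :
  measurable_fun setT X -> measurable_fun setT Y ->
  cmeasurable setT (fun p => Rz m z (X p) (Y p) i j).
Proof.
move=> mX mY; have mB : measurable_fun setT (fun p => X p - Y p) by exact: measurable_funB.
rewrite /Rz; apply: (@eq_cmeasurable _ _ _ _ (fun p =>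
  (iC / 2%:R * cexp (iC * kz m z * RtoC `|X p - Y p|)) *
  (Zmat m z i j + RtoC (Num.sg (X p - Y p)) * sigma1 i j))).
  by move=> p _; rewrite !mxE.
apply: cmeasurableM.
  apply: cmeasurableM; first exact: cmeasurable_cst.
  apply: cmeasurable_cexp; apply: cmeasurableM; first exact: cmeasurable_cst.
  by apply: cmeasurable_RtoC; exact: measurableT_comp.
apply: cmeasurableD; first exact: cmeasurable_cst.
apply: cmeasurableM; last exact: cmeasurable_cst.
by apply: cmeasurable_RtoC; apply: (measurableT_comp measurable_sgr).
Qed.

Lemma RAz_measurable (i j : 'I_2) :
  cmeasurable setT (fun p : R * R => RAz m A z p.1 p.2 i j).
Proof.
have mxM (M N : R * R -> 'M[R[i]]_2) :
    (forall i j, cmeasurable setT (fun p => M p i j)) ->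
    (forall i j, cmeasurable setT (fun p => N p i j)) ->
    forall i j, cmeasurable setT (fun p => (M p *m N p) i j).
  move=> mM mN k l; apply: (@eq_cmeasurable _ _ _ _ (fun p => \sum_n M p k n * N p n l)).
    by move=> p _; rewrite mxE.
  by apply: cmeasurable_sum => n; exact: cmeasurableM.
have cM (M : 'M[R[i]]_2) k l : cmeasurable setT (fun p : R * R => M k l).
  exact: cmeasurable_cst.
rewrite /RAz; set B := invmx _.
apply: (@eq_cmeasurable _ _ _ _ (fun p => Rz m z p.1 p.2 i j +
  - (Rz m z p.1 0 *m B *m A *m Rz m z 0 p.2) i j)).
  by move=> p _; rewrite mxBE.
apply: cmeasurableD; first exact: Rz_measurable.
apply: cmeasurableN; apply: (mxM _ _) => [|k l]; last exact: Rz_measurable.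
apply: (mxM _ _) => //; apply: (mxM _ _) => // k l; exact: Rz_measurable.
Qed.

End ResolventKernel.

(** * The free resolvent *)

Section VectorIntegral.
Context {R : realType}.
Implicit Types (D : set (measurableTypeR R)) (F G U g : R -> 'cV[R[i]]_2) (M : 'M[R[i]]_2).

Lemma mulmxE2 M (v : 'cV[R[i]]_2) (i : 'I_2) :
  (M *m v) i 0 = M i ord0 * v ord0 0 + M i ord_max * v ord_max 0.
Proof.
rewrite mxE !big_ord_recl big_ord0 addr0.
by have -> : lift ord0 ord0 = ord_max :> 'I_2 by exact/val_inj.
Qed.

Lemma eq_vint D F G : {in D, F =1 G} -> vint D F = vint D G.
Proof.
by move=> FG; apply/matrixP => i j; rewrite !mxE; apply: eq_cint => y Dy; rewrite FG.
Qed.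

Lemma eq_vintegrable D F G : measurable D -> {in D, F =1 G} ->
  vintegrable D F -> vintegrable D G.
Proof.
by move=> mD FG Fi i; apply: eq_cintegrable (Fi i) => // y Dy; rewrite FG.
Qed.

Lemma vintegrableS (E D : set (measurableTypeR R)) F : measurable E -> measurable D ->
  D `<=` E -> vintegrable E F -> vintegrable D F.
Proof. by move=> mE mD DE Fi i; apply: cintegrableS (Fi i). Qed.

Lemma vintegrable_mulmx D M F : measurable D -> vintegrable D F ->
  vintegrable D (fun y => M *m F y).
Proof.
move=> mD Fi i.
apply: (@eq_cintegrable _ _ (fun y => M i ord0 * F y ord0 0 + M i ord_max * F y ord_max 0)) => //.
  by move=> y _; rewrite mulmxE2.
by apply: cintegrableD => //; exact: cintegrableZ.
Qed.

Lemma vint_mulmx D M F : measurable D -> vintegrable D F ->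
  vint D (fun y => M *m F y) = M *m vint D F.
Proof.
move=> mD Fi; apply/matrixP => i j; rewrite ord1 mulmxE2 !mxE.
rewrite -(cintZ _ mD (Fi ord0)) -(cintZ _ mD (Fi ord_max)) -cintD//.
- by apply: eq_cint => y _; rewrite mulmxE2.
- exact: cintegrableZ.
- exact: cintegrableZ.
Qed.

Lemma vintD D F G : measurable D -> vintegrable D F -> vintegrable D G ->
  vint D (fun y => F y + G y) = vint D F + vint D G.
Proof.
move=> mD Fi Gi; apply/matrixP => i j; rewrite !mxE -cintD//.
by apply: eq_cint => y _; rewrite mxE.
Qed.

Lemma vint_setU (A B : set (measurableTypeR R)) F : measurable A -> measurable B ->
  vintegrable (A `|` B) F -> [disjoint A & B] ->
  vint (A `|` B) F = vint A F + vint B F.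
Proof.
by move=> mA mB Fi AB; apply/matrixP => i j; rewrite !mxE cint_setU//; exact: Fi.
Qed.

Definition vprimitive (a b : R) U g :=
  forall i : 'I_2, primitive a b (fun t => U t i 0) (fun t => g t i 0).

Lemma eq_vprimitive (a b : R) U1 U2 g1 g2 : a <= b -> (forall t, a <= t <= b -> U1 t = U2 t) ->
  (forall t, a < t <= b -> g1 t = g2 t) ->
  vprimitive a b U1 g1 -> vprimitive a b U2 g2.
Proof.
move=> ab U12 g12 p1 i; apply: eq_primitive (p1 i) => // t tab.
- by rewrite U12.
- by rewrite g12.
Qed.

Lemma vprimitiveD (a b : R) U1 U2 g1 g2 : vprimitive a b U1 g1 -> vprimitive a b U2 g2 ->
  vprimitive a b (fun t => U1 t + U2 t) (fun t => g1 t + g2 t).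
Proof.
move=> p1 p2 i; have := primitiveD (p1 i) (p2 i).
by congr primitive; apply/funext => t; rewrite mxE.
Qed.

Lemma vprimitive_mulmx (a b : R) M U g : vprimitive a b U g ->
  vprimitive a b (fun t => M *m U t) (fun t => M *m g t).
Proof.
move=> p i.
have := primitiveD (primitiveZ (M i ord0) (p ord0)) (primitiveZ (M i ord_max) (p ord_max)).
by congr primitive; apply/funext => t; rewrite mulmxE2.
Qed.

Lemma vprimitive_cexpRM (a b : R) lam U g (h : 'cV[R[i]]_2) : a <= b -> vprimitive a b U g ->
  vprimitive a b (fun t => cexpR lam t *: (U t - h))
    (fun t => cexpR lam t *: (lam *: (U t - h) + g t)).
Proof.
move=> ab p i; have := primitive_cexpRM lam ab (primitive_addc (- h i 0) (p i)).
by congr primitive; apply/funext => t; rewrite !mxE.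
Qed.

Lemma vprimitive_increment (a b : R) U g : a <= b -> vprimitive a b U g ->
  U b = U a + vint `]a, b] g.
Proof.
move=> ab p; apply/matrixP => i j; rewrite ord1 !mxE.
by have [_ ->] := p i; rewrite ?lexx ?ab.
Qed.

End VectorIntegral.

Section FreeResolvent.
Context {R : realType}.
Local Notation mu := (@lebesgue_measure R).
Implicit Types (x y a b : R) (h : R -> R[i]) (f : R -> 'cV[R[i]]_2).

(** For [y <= x] the modulus of [cexpR (- lam) y] is a constant depending on [x] times
    [exp (- kap |x - y|)] with [kap = - cre lam], so [integrable_exp_dom] applies. *)
Lemma cintegrable_exp_left (lam : R[i]) h x : cre lam < 0 -> cL2 setT h ->
  cintegrable `]-oo, x] (fun y => cexpR (- lam) y * h y).
Proof.
move=> lam0 [mh hi]; have kap0 : 0 < - cre lam by rewrite oppr_gt0.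
have mn := measurable_norm1 mh.
have ie := integrable_exp_dom kap0 mn hi x.
have ie' := integrableZl measurableT (2 * expR (- cre lam * x)) ie.
have {ie ie'} : mu.-integrable `]-oo, x] (EFin \o (fun y =>
    2 * expR (- cre lam * x) * (expR (- - cre lam * `|x - y|) * norm1 (h y)))).
  by apply: integrableS ie'.
move=> /(cintegrable_dom _ _); apply => //.
  apply: cmeasurableM; last exact: cmeasurableS mh.
  apply: cmeasurable_cexp; apply: cmeasurableM; first exact: cmeasurable_cst.
  exact: cmeasurable_RtoC.
move=> y; rewrite /= in_itv /= => yx.
apply: (le_trans (norm1M _ _)); rewrite mulrA ler_wpM2r ?norm1_ge0//.
apply: (le_trans (norm1_cexpR _ _)); rewrite -mulrA ler_pM2l// -expRD ler_expR.
by rewrite creN ger0_norm ?subr_ge0//; lra.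
Qed.

Lemma cintegrable_exp_right (lam : R[i]) h x : cre lam < 0 -> cL2 setT h ->
  cintegrable `]x, +oo[ (fun y => cexpR lam y * h y).
Proof.
move=> lam0 [mh hi]; have kap0 : 0 < - cre lam by rewrite oppr_gt0.
have mn := measurable_norm1 mh.
have ie := integrable_exp_dom kap0 mn hi x.
have ie' := integrableZl measurableT (2 * expR (cre lam * x)) ie.
have {ie ie'} : mu.-integrable `]x, +oo[ (EFin \o (fun y =>
    2 * expR (cre lam * x) * (expR (- - cre lam * `|x - y|) * norm1 (h y)))).
  by apply: integrableS ie'.
move=> /(cintegrable_dom _ _); apply => //.
  apply: cmeasurableM; last exact: cmeasurableS mh.
  apply: cmeasurable_cexp; apply: cmeasurableM; first exact: cmeasurable_cst.
  exact: cmeasurable_RtoC.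
move=> y; rewrite /= in_itv /= andbT => /ltW yx.
apply: (le_trans (norm1M _ _)); rewrite mulrA ler_wpM2r ?norm1_ge0//.
apply: (le_trans (norm1_cexpR _ _)); rewrite -mulrA ler_pM2l// -expRD ler_expR.
by rewrite ler0_norm ?subr_le0//; lra.
Qed.

Lemma primitive_left a b (g : R -> R[i]) : cintegrable `]-oo, b] g ->
  primitive a b (fun x => cint `]-oo, x] g) g.
Proof.
move=> gi; split; first by apply: cintegrableS gi => //; exact: subset_itvr.
move=> t /andP[at_ tb].
have E : `]-oo, t]%classic = `]-oo, a] `|` `]a, t] :> set R by rewrite -itv_bndbnd_setU.
rewrite E cint_setU//.
- by rewrite -E; apply: cintegrableS gi => //; apply: subset_itvl; rewrite bnd_simp.
- rewrite disj_set2E; apply/eqP; rewrite -subset0 => y [] /=.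
  by rewrite !in_itv /= => h /andP[/(le_lt_trans h)]; rewrite ltxx.
Qed.

Lemma primitive_right a b (g : R -> R[i]) : cintegrable `]a, +oo[ g ->
  primitive a b (fun x => cint `]x, +oo[ g) (fun x => - g x).
Proof.
move=> gi.
have iab t : cintegrable `]a, t] g.
  by apply: cintegrableS gi => //; exact: subset_itvl.
split; first by apply: cintegrableN => //; exact: iab.
move=> t /andP[at_ tb].
have E : `]a, +oo[%classic = `]a, t] `|` `]t, +oo[ :> set R by rewrite -itv_bndbnd_setU.
rewrite [in RHS]E cint_setU//.
- by rewrite cintN// addrAC subrr add0r.
- by rewrite -E.
- rewrite disj_set2E; apply/eqP; rewrite -subset0 => y [] /=.
  by rewrite !in_itv /= andbT => /andP[_ h] /(le_lt_trans h); rewrite ltxx.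
Qed.

Variables (m : R) (z : R[i]).
Hypothesis kap0 : 0 < cim (kz m z).
Local Notation lam := (iC * kz m z).
Variable f : R -> 'cV[R[i]]_2.
Hypothesis fL2 : L2on setT f.

Let lam_lt0 : cre lam < 0.
Proof. by rewrite cre_iCM oppr_lt0. Qed.

Let fi (i : 'I_2) : cL2 setT (fun x => f x i 0).
Proof. exact: ((L2onP f measurableT).1 fL2). Qed.

(** [cexpR lam x *: free_left x] is the function [P] of the overview, and
    [cexpR (- lam) x *: free_right x] is [Q]. With the exponential in [x] factored out, what remains
    is a plain integral with a moving endpoint. *)
Definition free_left x := vint `]-oo, x] (fun y => cexpR (- lam) y *: f y).
Definition free_right x := vint `]x, +oo[ (fun y => cexpR lam y *: f y).

Let left_integrable x : vintegrable `]-oo, x] (fun y => cexpR (- lam) y *: f y).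
Proof.
move=> i; apply: eq_cintegrable (cintegrable_exp_left x lam_lt0 (fi i)) => // y _.
by rewrite mxE.
Qed.

Let right_integrable x : vintegrable `]x, +oo[ (fun y => cexpR lam y *: f y).
Proof.
move=> i; apply: eq_cintegrable (cintegrable_exp_right x lam_lt0 (fi i)) => // y _.
by rewrite mxE.
Qed.

(** Subtracting the constant [h] adds a solution of the homogeneous equation. This freedom later
    absorbs the correction term of the kernel. *)
Lemma vprimitive_free_left a b (h : 'cV[R[i]]_2) : a <= b ->
  vprimitive a b (fun t => cexpR lam t *: (free_left t - h))
    (fun t => lam *: (cexpR lam t *: (free_left t - h)) + f t).
Proof.
move=> ab; have p : vprimitive a b free_left (fun y => cexpR (- lam) y *: f y).
  move=> i; have := primitive_left a (left_integrable b i).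
  by congr primitive; apply/funext => t; rewrite mxE.
apply: eq_vprimitive (vprimitive_cexpRM lam h ab p) => // t _.
rewrite scalerDr !scalerA [lam * _]mulrC; congr (_ + _).
by rewrite mulrC cexpRNM scale1r.
Qed.

Lemma vprimitive_free_right a b (h : 'cV[R[i]]_2) : a <= b ->
  vprimitive a b (fun t => cexpR (- lam) t *: (free_right t - h))
    (fun t => - (lam *: (cexpR (- lam) t *: (free_right t - h)) + f t)).
Proof.
move=> ab; have p : vprimitive a b free_right (fun y => - (cexpR lam y *: f y)).
  move=> i; have := primitive_right b (right_integrable a i).
  by congr primitive; apply/funext => t; rewrite !mxE.
apply: eq_vprimitive (vprimitive_cexpRM (- lam) h ab p) => // t _.
rewrite scalerDr scalerN !scalerA cexpRNM scale1r opprD; congr (_ - _).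
by rewrite mulrN mulrC scaleNr.
Qed.

Lemma Rz_left x y : y < x ->
  Rz m z x y = (iC / 2%:R * cexpR lam x * cexpR (- lam) y) *: (Zmat m z + sigma1).
Proof.
move=> yx; have d0 : 0 < x - y by rewrite subr_gt0.
rewrite /Rz gtr0_norm// gtr0_sg// RtoC1 scale1r -/(cexpR lam (x - y)) cexpRD mulrA.
by rewrite [cexpR (- lam) y]/cexpR mulNr -mulrN -RtoCN.
Qed.

Lemma Rz_right x y : x < y ->
  Rz m z x y = (iC / 2%:R * cexpR (- lam) x * cexpR lam y) *: (Zmat m z - sigma1).
Proof.
move=> xy; have d0 : x - y < 0 by rewrite subr_lt0.
rewrite /Rz ltr0_norm// ltr0_sg// [RtoC (-1)]RtoCN RtoC1 scaleN1r opprB addrC.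
rewrite -/(cexpR lam (- x + y)) cexpRD mulrA.
by rewrite [cexpR (- lam) x]/cexpR mulNr -mulrN -RtoCN.
Qed.

Lemma vintegrable_Rz x : vintegrable setT (fun y => Rz m z x y *m f y).
Proof.
have [c c0 cR] := Rz_bound m z.
apply: (vintegrable_kernel kap0 _ cR x fL2) => i j.
exact: Rz_measurable.
Qed.

Lemma free_resolvent x : vint setT (fun y => Rz m z x y *m f y) =
  iC / 2%:R *: ((Zmat m z + sigma1) *m (cexpR lam x *: free_left x) +
              (Zmat m z - sigma1) *m (cexpR (- lam) x *: free_right x)).
Proof.
have vi := vintegrable_Rz x.
have E : [set: R] = `]-oo, x] `|` `]x, +oo[.
  apply/esym/seteqP; split=> // y _ /=.
  by rewrite !in_itv /= andbT; case: (leP y x); [left|right].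
have vl : vintegrable `]-oo, x[ (fun y => Rz m z x y *m f y) by apply: vintegrableS vi.
rewrite E vint_setU//; last 2 first.
- by rewrite -E.
- rewrite disj_set2E; apply/eqP; rewrite -subset0 => y [] /=.
  by rewrite !in_itv /= andbT => h /(le_lt_trans h); rewrite ltxx.
rewrite scalerDr; congr (_ + _).
  (* At [y = x] the sign is 0, so the kernel there is given by neither [Rz_left] nor [Rz_right]; the
     point is removed before the formula for [y < x] is used. *)
  have -> : vint `]-oo, x] (fun y => Rz m z x y *m f y) =
            vint `]-oo, x[ (fun y => Rz m z x y *m f y).
    by apply/matrixP => i j; rewrite !mxE cint_itv_bndo_bndc//; exact: vl.
  have -> : free_left x = vint `]-oo, x[ (fun y => cexpR (- lam) y *: f y).
    apply/matrixP => i j; rewrite !mxE cint_itv_bndo_bndc//.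
    by apply: (vintegrableS _ _ _ (left_integrable x)) => //; apply: subset_itvl; rewrite bnd_simp.
  rewrite -scalemxAr scalerA scalemxAl -vint_mulmx//.
    apply: eq_vint => y; rewrite inE /= in_itv /= => yx.
    by rewrite Rz_left// -!scalemxAl -scalemxAr scalerA.
  by apply: (vintegrableS _ _ _ (left_integrable x)) => //; apply: subset_itvl; rewrite bnd_simp.
rewrite -scalemxAr scalerA scalemxAl -vint_mulmx//.
apply: eq_vint => y; rewrite inE /= in_itv /= andbT => yx.
by rewrite Rz_right// -!scalemxAl -scalemxAr scalerA.
Qed.

End FreeResolvent.

(** * Surjectivity *)

Section L2Vectors.
Context {R : realType}.
Implicit Types (D : set (measurableTypeR R)) (F G : R -> 'cV[R[i]]_2).

Lemma L2on_mulmx D (M : 'M[R[i]]_2) F : measurable D -> L2on D F ->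
  L2on D (fun x => M *m F x).
Proof.
move=> mD /(L2onP _ mD) FL2; apply/(L2onP _ mD) => i.
apply: (eq_cL2 mD _ (cL2D mD (cL2Z (M i ord0) mD (FL2 ord0)) (cL2Z (M i ord_max) mD (FL2 ord_max)))).
by move=> x _; rewrite mulmxE2.
Qed.

Lemma L2onD D F G : measurable D -> L2on D F -> L2on D G -> L2on D (fun x => F x + G x).
Proof.
move=> mD /(L2onP _ mD) FL2 /(L2onP _ mD) GL2; apply/(L2onP _ mD) => i.
by apply: (eq_cL2 mD _ (cL2D mD (FL2 i) (GL2 i))) => x _; rewrite mxE.
Qed.

Lemma L2onS (E D : set (measurableTypeR R)) F : measurable E -> measurable D -> D `<=` E ->
  L2on E F -> L2on D F.
Proof.
move=> mE mD DE /(L2onP _ mE) FL2; apply/(L2onP _ mD) => i.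
exact: cL2S (FL2 i).
Qed.

Lemma measurable_Rpos : measurable (Rpos : set (measurableTypeR R)).
Proof.
rewrite (_ : Rpos = `]0, +oo[%classic)//.
by apply/seteqP; split => x; rewrite /Rpos /= in_itv /= andbT.
Qed.

Lemma measurable_Rneg : measurable (Rneg : set (measurableTypeR R)).
Proof.
rewrite (_ : Rneg = `]-oo, 0[%classic)//.
Qed.

Lemma set_itv_oc (a b : R) : [set y | a < y <= b] = `]a, b]%classic.
Proof. by apply/seteqP; split => x; rewrite /= in_itv. Qed.

Lemma set_itv_co (a b : R) : [set y | a <= y < b] = `[a, b[%classic.
Proof. by apply/seteqP; split => x; rewrite /= in_itv. Qed.

End L2Vectors.

Section HalfLines.
Context {R : realType}.
Implicit Types (U gU g : R -> 'cV[R[i]]_2) (x : R).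

Lemma vprimitive_pos U gU g x : 0 < x -> vprimitive 0 x U gU ->
  (forall t, 0 < t -> gU t = g t) ->
  U x = U 0 + vint [set y | 0 < y <= x] g.
Proof.
move=> x0 p gE; rewrite set_itv_oc (vprimitive_increment (ltW x0) p).
by congr (_ + _); apply: eq_vint => t; rewrite inE /= in_itv /= => /andP[/gE].
Qed.

(** [H1_neg] integrates over [[x, 0[] and [vprimitive] over []x, 0]], and [gU] and [g] need not
    agree at [0]. The integrals are compared on the open interval. *)
Lemma vprimitive_neg U gU g x : x < 0 -> vprimitive x 0 U gU ->
  (forall t, t < 0 -> gU t = g t) ->
  U x = U 0 - vint [set y | x <= y < 0] g.
Proof.
move=> x0 p gE; rewrite set_itv_co (vprimitive_increment (ltW x0) p).
have gUi : vintegrable `]x, 0[ gU.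
  apply: vintegrableS (fun i => (p i).1) => //.
  by apply: subset_itvl; rewrite bnd_simp.
have E : {in `]x, 0[%classic, gU =1 g}.
  by move=> t; rewrite inE /= in_itv /= => /andP[_ /gE].
have gi := eq_vintegrable (measurable_itv `]x, 0[) E gUi.
have -> : vint `]x, 0] gU = vint `[x, 0[ g; last by rewrite addrK.
apply/matrixP => i j; rewrite !mxE.
rewrite -(cint_itv_bndo_bndc (gUi i)) -(cint_itv_obnd_cbnd (gi i)).
by apply: eq_cint => t xt; rewrite E.
Qed.

End HalfLines.

(** * Algebra of two-component vectors and of the transmission condition *)

Section TwoComponents.
Context {R : realType}.
Implicit Types (u v : 'cV[R[i]]_2) (c : R[i]).

Lemma cV2_ext u v : u ord0 0 = v ord0 0 -> u ord_max 0 = v ord_max 0 -> u = v.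
Proof.
move=> e0 e1; apply/matrixP => i j; rewrite ord1.
have [->|->] // : i = ord0 \/ i = ord_max.
by case: i => [[|[]]] // ?; [left|right]; exact/val_inj.
Qed.

Lemma cV2D u v i : (u + v) i 0 = u i 0 + v i 0. Proof. by rewrite mxE. Qed.
Lemma cV2N u i : (- u) i 0 = - u i 0. Proof. by rewrite mxE. Qed.
Lemma cV2Z c u i : (c *: u) i 0 = c * u i 0. Proof. by rewrite mxE. Qed.

Lemma sigma1_fst u : (sigma1 *m u) ord0 0 = u ord_max 0.
Proof. by rewrite mulmxE2 !mxE /= mul0r mul1r add0r. Qed.
Lemma sigma1_snd u : (sigma1 *m u) ord_max 0 = u ord0 0.
Proof. by rewrite mulmxE2 !mxE /= mul0r mul1r addr0. Qed.
Lemma sigma1_sqr : sigma1 *m sigma1 = 1%:M :> 'M[R[i]]_2.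
Proof.
apply/matrixP => i j; rewrite mxE !big_ord_recl big_ord0 !mxE.
by case: i => [[|[]]] // ?; case: j => [[|[]]] // ? /=; rewrite ?mulr0 ?mul0r ?mulr1 ?addr0 ?add0r.
Qed.
Lemma sigma3_fst u : (sigma3 *m u) ord0 0 = u ord0 0.
Proof. by rewrite mulmxE2 !mxE /= mul0r mul1r addr0. Qed.
Lemma sigma3_snd u : (sigma3 *m u) ord_max 0 = - u ord_max 0.
Proof. by rewrite mulmxE2 !mxE /= mul0r mulN1r add0r. Qed.
Lemma Zmat_fst m z u : (Zmat m z *m u) ord0 0 = zeta m z * u ord0 0.
Proof. by rewrite mulmxE2 !mxE /= mul0r addr0. Qed.
Lemma Zmat_snd m z u : (Zmat m z *m u) ord_max 0 = (zeta m z)^-1 * u ord_max 0.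
Proof. by rewrite mulmxE2 !mxE /= mul0r add0r. Qed.

Definition cV2E := (mulmxDl, mulNmx, cV2D, cV2N, cV2Z, sigma1_fst, sigma1_snd,
  sigma3_fst, sigma3_snd, Zmat_fst, Zmat_snd).

End TwoComponents.

Section Outgoing.
Context {F : numFieldType}.
Variables (i k zt z M P0 P1 Q0 Q1 w0 w1 : F).
Hypothesis zt_neq0 : zt != 0.

(** [sigma1] swaps the components: the first row of the system contains only [u_2], with coefficient
    [z + M = zeta k], and the second only [u_1], with [z - M = k / zeta]. Eliminating [z] by this
    relation leaves a rational identity. *)
Lemma outgoing_fst : z + M = zt * k ->
  i / 2%:R * (zt * (i * k * P0 + w0) + (i * k * P1 + w1) +
    (zt * - (i * k * Q0 + w0) - - (i * k * Q1 + w1))) =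
  i * (w1 + z * (i / 2%:R * (zt^-1 * P1 + P0 + (zt^-1 * Q1 - Q0))) -
    M * - (i / 2%:R * (zt^-1 * P1 + P0 + (zt^-1 * Q1 - Q0)))).
Proof.
by move=> e; have -> : z = zt * k - M by [rewrite -e addrK]; field.
Qed.

Lemma outgoing_snd : z - M = k / zt ->
  i / 2%:R * (zt^-1 * (i * k * P1 + w1) + (i * k * P0 + w0) +
    (zt^-1 * - (i * k * Q1 + w1) - - (i * k * Q0 + w0))) =
  i * (w0 + z * (i / 2%:R * (zt * P0 + P1 + (zt * Q0 - Q1))) -
    M * (i / 2%:R * (zt * P0 + P1 + (zt * Q0 - Q1)))).
Proof.
by move=> e; have -> : z = k / zt + M by [rewrite -e subrK]; field.
Qed.

End Outgoing.

Section TransmissionAlgebra.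
Context {F : numFieldType}.

(** The two vectors have difference [- i S h] and sum [2 v - i Z h]. The claim says that [2 i S]
    times the difference is [A] times the sum, which by [i^2 = -1] and [S^2 = 1] is twice the
    hypothesis on [h]. *)
Lemma transmission_algebra n (S Z A : 'M[F]_n) (h v : 'cV[F]_n) (i : F) :
  i * i = -1 -> S *m S = 1%:M ->
  h + i / 2%:R *: (A *m (Z *m h)) = A *m v ->
  ((2%:R * i) *: S - A) *m (v - i / 2%:R *: ((Z + S) *m h)) =
  ((2%:R * i) *: S + A) *m (v - i / 2%:R *: ((Z - S) *m h)).
Proof.
move=> ii SS /(canRL (addrK _)) hE.
rewrite (mulmxDl Z S h) (mulmxBl Z S h); set p := Z *m h in hE *; set s := S *m h.
have Ss : S *m s = A *m v - i / 2%:R *: (A *m p) by rewrite mulmxA SS mul1mx.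
clearbody p s.
rewrite (mulmxBl ((2%:R * i) *: S) A) (mulmxDl ((2%:R * i) *: S) A) -!scalemxAl !(mulmxBr _ v) -!scalemxAr !(mulmxDr _ p s) !(mulmxBr _ p s) Ss.
move: (S *m v) (S *m p) (A *m v) (A *m p) (A *m s) => X1 X2 X3 X4 X5.
apply/matrixP => r c; rewrite !mxE; apply/subr0_eq.
(* As a polynomial identity in [i] the claim fails; the two sides differ by an explicit multiple of
   [i^2 + 1]. *)
transitivity ((i * i + 1) * (- 2%:R * (X3 r c - i / 2%:R * X4 r c))); last first.
  by rewrite ii addNr mul0r.
by field.
Qed.

End TransmissionAlgebra.

Section BranchAlgebra.
Context {F : fieldType}.
Implicit Types (M N : 'M[F]_2) (a b h : 'cV[F]_2) (c e : F).

(** On the right half-line [R_z(x, 0)] carries the same exponential and the same matrix [Z + sigma1]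
    as the left part of the free resolvent, so subtracting [R_z(x, 0) h] only shifts the constant
    inside that part. *)
Lemma subtract_left c e M N a b h :
  c *: (M *m (e *: a) + N *m b) - ((c * e) *: M) *m h =
  c *: (M *m (e *: (a - h)) + N *m b).
Proof.
rewrite -scalemxAl -scalerA -scalerBr; congr (_ *: _).
by rewrite addrAC scalerBr mulmxBr -!scalemxAr.
Qed.

Lemma subtract_right c e M N a b h :
  c *: (M *m a + N *m (e *: b)) - ((c * e) *: N) *m h =
  c *: (M *m a + N *m (e *: (b - h))).
Proof. by rewrite ![M *m _ + _]addrC subtract_left. Qed.

End BranchAlgebra.

Section RankOneKernel.
Context {R : realType}.
Variables (m : R) (z : R[i]).
Local Notation lam := (iC * kz m z).

Lemma Rz_pos (x : R) : 0 < x ->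
  Rz m z x 0 = (iC / 2%:R * cexpR lam x) *: (Zmat m z + sigma1).
Proof. by move=> x0; rewrite Rz_left// cexpR0 mulr1. Qed.

Lemma Rz_neg (x : R) : x < 0 ->
  Rz m z x 0 = (iC / 2%:R * cexpR (- lam) x) *: (Zmat m z - sigma1).
Proof. by move=> x0; rewrite Rz_right// cexpR0 mulr1. Qed.

Lemma vintB_mulmx (F G : R -> 'cV[R[i]]_2) (M : 'M[R[i]]_2) :
  vintegrable setT F -> vintegrable setT G ->
  vint setT (fun y => F y - M *m G y) = vint setT F - M *m vint setT G.
Proof.
move=> Fi Gi; have E : {in setT, (fun y => F y - M *m G y) =1 (fun y => F y + (- M) *m G y)}.
  by move=> y _; rewrite mulNmx.
rewrite (eq_vint E) (vintD measurableT Fi (vintegrable_mulmx (- M) measurableT Gi)).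
by rewrite (vint_mulmx (- M) measurableT Gi) (mulNmx M).
Qed.

Lemma vint_rank_one (K1 K2 : R -> 'M[R[i]]_2) (L B A : 'M[R[i]]_2) (f : R -> 'cV[R[i]]_2) :
  vintegrable setT (fun y => K1 y *m f y) -> vintegrable setT (fun y => K2 y *m f y) ->
  vint setT (fun y => (K1 y - L *m B *m A *m K2 y) *m f y) =
  vint setT (fun y => K1 y *m f y) - L *m (B *m A *m vint setT (fun y => K2 y *m f y)).
Proof.
move=> K1i K2i; rewrite !mulmxA -(vintB_mulmx (L *m B *m A) K1i K2i).
by apply: eq_vint => y _; rewrite mulmxBl [RHS]addrC [LHS]addrC -!mulmxA.
Qed.

End RankOneKernel.

Section Surjectivity.
Context {R : realType}.
Variables (m : R) (A : 'M[R[i]]_2) (z : R[i]).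
Hypothesis z_resolvent : ~ (cim z = 0 /\ `|m| <= `|cre z|).
Hypothesis det_neq0 : \det (sigma0 + (iC / 2%:R) *: (A *m Zmat m z)) != 0.
Local Notation lam := (iC * kz m z).

Let kap0 : 0 < cim (kz m z). Proof. exact: kz_gt0. Qed.

Definition dirac_derivative (w u : 'cV[R[i]]_2) : 'cV[R[i]]_2 :=
  iC *: (sigma1 *m (w + z *: u - RtoC m *: (sigma3 *m u))).

Lemma Dexpr_derivative (f u : R -> 'cV[R[i]]_2) x :
  Dexpr m u (fun t => dirac_derivative (f t) (u t)) x - z *: u x = f x.
Proof.
rewrite /Dexpr /dirac_derivative -scalemxAr scalerA mulNr iC_sqr opprK scale1r.
by rewrite mulmxA sigma1_sqr mul1mx subrK addrK.
Qed.

(** The columns of [Z + sigma1] are multiples of [(zeta, 1)] and those of [Z - sigma1] multiples of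
    [(zeta, -1)]. These are the eigenvectors of [i sigma1 (z - m sigma3)] for [i k] and [- i k]. The
    source terms combine to [i/2 ((Z + sigma1) - (Z - sigma1)) w = i sigma1 w]. *)
Lemma outgoing_derivative (P Q w : 'cV[R[i]]_2) :
  iC / 2%:R *: ((Zmat m z + sigma1) *m (lam *: P + w) + (Zmat m z - sigma1) *m (- (lam *: Q + w))) =
  dirac_derivative w (iC / 2%:R *: ((Zmat m z + sigma1) *m P + (Zmat m z - sigma1) *m Q)).
Proof.
have zN0 := zeta_neq0 z_resolvent.
have e1 : z + RtoC m = zeta m z * kz m z by rewrite zeta_kz.
have e2 : z - RtoC m = kz m z / zeta m z.
  by rewrite -[in RHS](zeta_zBm z_resolvent) mulrAC mulfV// mul1r.
rewrite /dirac_derivative; apply: cV2_ext; rewrite !cV2E.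
- exact: outgoing_fst.
- exact: outgoing_snd.
Qed.

(* [Gl], [Gr] and [u] stand for [free_left], [free_right] and [R_z^A f]; keeping them
   abstract prevents unification from unfolding the integrals. *)
Variables (f u Gl Gr : R -> 'cV[R[i]]_2) (h v0 : 'cV[R[i]]_2).
Hypotheses (fL2 : L2on setT f) (uL2 : L2on setT u).
Hypothesis Gl_primitive : forall (c : 'cV[R[i]]_2) (a b : R), a <= b ->
  vprimitive a b (fun t => cexpR lam t *: (Gl t - c))
    (fun t => lam *: (cexpR lam t *: (Gl t - c)) + f t).
Hypothesis Gr_primitive : forall (c : 'cV[R[i]]_2) (a b : R), a <= b ->
  vprimitive a b (fun t => cexpR (- lam) t *: (Gr t - c))
    (fun t => - (lam *: (cexpR (- lam) t *: (Gr t - c)) + f t)).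

Let free x := iC / 2%:R *: ((Zmat m z + sigma1) *m (cexpR lam x *: Gl x) +
                            (Zmat m z - sigma1) *m (cexpR (- lam) x *: Gr x)).
Hypothesis v0E : v0 = free 0.
Hypothesis hE : h = invmx (sigma0 + (iC / 2%:R) *: (A *m Zmat m z)) *m A *m v0.
Hypothesis uE : forall x, u x = free x - Rz m z x 0 *m h.

(** Continues each half of [u] across [0]: [u] is [branch h 0] on the right and [branch 0 h] on the
    left, and both solve the equation on the whole line. *)
Let branch (h1 h2 : 'cV[R[i]]_2) x := iC / 2%:R *:
  ((Zmat m z + sigma1) *m (cexpR lam x *: (Gl x - h1)) +
   (Zmat m z - sigma1) *m (cexpR (- lam) x *: (Gr x - h2))).

Let vprimitive_branch (h1 h2 : 'cV[R[i]]_2) (a b : R) : a <= b ->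
  vprimitive a b (branch h1 h2) (fun t => dirac_derivative (f t) (branch h1 h2 t)).
Proof.
move=> ab.
have pl := vprimitive_mulmx (Zmat m z + sigma1) (Gl_primitive h1 ab).
have pr := vprimitive_mulmx (Zmat m z - sigma1) (Gr_primitive h2 ab).
have := vprimitive_mulmx ((iC / 2%:R)%:M) (vprimitiveD pl pr).
apply: (eq_vprimitive ab) => t _; first exact: mul_scalar_mx.
exact: etrans (mul_scalar_mx _ _) (outgoing_derivative _ _ _).
Qed.

Let u_pos x : 0 < x -> u x = branch h 0 x.
Proof.
move=> x0; rewrite uE (Rz_pos m z x0) /branch subr0.
exact: subtract_left.
Qed.

Let u_neg x : x < 0 -> u x = branch 0 h x.
Proof.
move=> x0; rewrite uE (Rz_neg m z x0) /branch subr0.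
exact: subtract_right.
Qed.

Let branch0 (h1 h2 : 'cV[R[i]]_2) : branch h1 h2 0 =
  v0 - iC / 2%:R *: ((Zmat m z + sigma1) *m h1 + (Zmat m z - sigma1) *m h2).
Proof.
rewrite v0E /branch /free !cexpR0 !scale1r -scalerBr.
by rewrite (mulmxBr _ (Gl 0)) (mulmxBr _ (Gr 0)) addrACA -opprD.
Qed.

Let transmission :
  ((2%:R * iC) *: sigma1 - A) *m branch h 0 0 = ((2%:R * iC) *: sigma1 + A) *m branch 0 h 0.
Proof.
have e : h + iC / 2%:R *: (A *m (Zmat m z *m h)) = A *m v0.
  have Bu : sigma0 + (iC / 2%:R) *: (A *m Zmat m z) \in unitmx.
    by rewrite unitmxE unitfE.
  have : (sigma0 + (iC / 2%:R) *: (A *m Zmat m z)) *m h = A *m v0.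
    by rewrite hE !mulmxA mulmxV// mul1mx.
  by rewrite mulmxDl /sigma0 mul1mx -scalemxAl -mulmxA.
rewrite !branch0 !mulmx0 addr0 add0r.
exact: transmission_algebra iC_sqr sigma1_sqr e.
Qed.

Let g x := dirac_derivative (f x) (u x).

Let gL2 : L2on setT g.
Proof.
have := L2onD measurableT (L2on_mulmx (iC *: sigma1) measurableT fL2)
  (L2on_mulmx ((iC *: sigma1) *m (z%:M - RtoC m *: sigma3)) measurableT uL2).
congr L2on; apply/funext => x.
rewrite /g /dirac_derivative -mulmxA mulmxBl mul_scalar_mx -!scalemxAl -scalerDr -mulmxDr.
by rewrite addrA.
Qed.

Lemma transmission_in_dom : exists gm gp cm cp, in_dom_DA A u gm gp cm cp /\
  {ae leb, forall x, x < 0 -> Dexpr m u gm x - z *: u x = f x} /\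
  {ae leb, forall x, 0 < x -> Dexpr m u gp x - z *: u x = f x}.
Proof.
exists g, g, (branch 0 h 0), (branch h 0 0); split; last first.
  by split; apply: aeW => x _; exact: Dexpr_derivative.
have mp := @measurable_Rpos R; have mn := @measurable_Rneg R.
split; [split; [|split]|split; [split; [|split]|]].
- exact (L2onS measurableT mn (fun x _ => I) uL2).
- exact (L2onS measurableT mn (fun x _ => I) gL2).
- move=> x x0; rewrite (u_neg x0).
  apply: (vprimitive_neg x0 (vprimitive_branch 0 h (ltW x0))) => t t0.
  by rewrite /g (u_neg t0).
- exact (L2onS measurableT mp (fun x _ => I) uL2).
- exact (L2onS measurableT mp (fun x _ => I) gL2).
- move=> x x0; rewrite (u_pos x0).
  apply: (vprimitive_pos x0 (vprimitive_branch h 0 (ltW x0))) => t t0.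
  by rewrite /g (u_pos t0).
- exact: transmission.
Qed.

End Surjectivity.

(** * Injectivity *)

Section AlmostEverywhere.
Context {R : realType}.
Local Notation mu := (@lebesgue_measure R).
Implicit Types (P Q : R -> Prop).

Let ae_filter := ae_filter_ringOfSetsType mu.

Lemma ae_imply P Q : (forall x, P x -> Q x) ->
  {ae mu, forall x, P x} -> {ae mu, forall x, Q x}.
Proof. by move=> PQ; exact: (@filterS _ _ ae_filter). Qed.

Lemma ae_and P Q : {ae mu, forall x, P x} -> {ae mu, forall x, Q x} ->
  {ae mu, forall x, P x /\ Q x}.
Proof. exact: (@filterI _ _ ae_filter). Qed.

Lemma ae_neq (a : R) : {ae mu, forall x, x <> a}.
Proof.
exists [set a]; split => //; first exact: lebesgue_measure_set1.
by move=> x /= /contrapT.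
Qed.

End AlmostEverywhere.

Section ExponentialSolutions.
Context {R : realType}.
Local Notation mu := (@lebesgue_measure R).
Implicit Types (a b t : R) (lam c : R[i]) (g G h : R -> R[i]).

Lemma ae_eq_primitive a b G g1 g2 : a <= b -> cintegrable `]a, b] g2 ->
  {ae mu, forall x, a < x <= b -> g1 x = g2 x} ->
  primitive a b G g1 -> primitive a b G g2.
Proof.
move=> ab i2 g12 [i1 E1]; split=> // t atb; rewrite (E1 t atb); congr (_ + _).
have /andP[at_ tb] := atb.
have sub : `]a, t] `<=` `]a, b] by apply: subset_itvl; rewrite bnd_simp.
apply: ae_eq_cint => //.
- exact: cintegrable_cmeasurable (cintegrableS _ _ sub i1).
- exact: cintegrable_cmeasurable (cintegrableS _ _ sub i2).
- apply: ae_imply g12 => x g12; rewrite /= in_itv /= => /andP[ax xt].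
  by apply: g12; rewrite ax (le_trans xt).
Qed.

Lemma cint_cst0 (D : set (measurableTypeR R)) : cint D (fun=> 0) = 0.
Proof. by rewrite /cint /= /Rintegral integral0. Qed.

(** [cexpR (- lam) t * G t] has derivative 0 and hence equal values at [a] and [b]. Multiplying by
    both exponentials removes the negative exponents. *)
Lemma primitive_exponential a b lam G : a <= b ->
  primitive a b G (fun t => lam * G t) -> cexpR lam a * G b = cexpR lam b * G a.
Proof.
move=> ab p; have [_ /(_ b)] := primitive_cexpRM (- lam) ab p.
rewrite ab lexx => /(_ isT).
have z0 : {in `]a, b]%classic, (fun t => cexpR (- lam) t * (- lam * G t + lam * G t)) =1 (fun=> 0)}.
  by move=> t _; rewrite mulNr addNr mulr0.
rewrite (eq_cint z0) cint_cst0 addr0 => E.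
have := congr1 (fun w => cexpR lam a * cexpR lam b * w) E.
have na := cexpRNM lam a; have nb := cexpRNM lam b.
have -> : cexpR lam a * cexpR lam b * (cexpR (- lam) b * G b) =
  cexpR lam a * G b * (cexpR (- lam) b * cexpR lam b) by ring.
have -> : cexpR lam a * cexpR lam b * (cexpR (- lam) a * G a) =
  cexpR lam b * G a * (cexpR (- lam) a * cexpR lam a) by ring.
by rewrite na nb !mulr1.
Qed.

Lemma cL2_infinite_measure (D : set (measurableTypeR R)) h (d : R) : measurable D ->
  mu D = +oo%E -> cL2 D h ->
  (forall x, D x -> d <= cre (h x) ^+ 2 + cim (h x) ^+ 2) -> d <= 0.
Proof.
move=> mD Doo [mh hi] dh; rewrite leNgt; apply/negP => d0.
have /integrableP[mi] := hi; apply/negP; rewrite -leNgt.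
apply: (@le_trans _ _ (\int[mu]_(x in D) (cst d%:E x))%E).
  by rewrite integral_cst// [X in (_ * X)%E](Doo : _ = +oo%E) gt0_muley// lte_fin.
apply: ge0_le_integral => //.
- by move=> x _; rewrite lee_fin ltW.
- exact: measurableT_comp.
- move=> x Dx; rewrite lee_fin ger0_norm ?sqr_ge0//.
  exact: le_trans (dh x Dx) (le_norm1_sqr _).
Qed.

(** On [D] the exponential has modulus at least 1, so [|h|^2 >= |c|^2] on a set of infinite
    measure. *)
Lemma exponential_not_L2 (D : set (measurableTypeR R)) lam c h : measurable D ->
  mu D = +oo%E -> cL2 D h -> (forall t, D t -> h t = cexpR lam t * c) ->
  (forall t, D t -> 0 <= cre lam * t) -> c = 0.
Proof.
move=> mD Doo hL2 hE lam0.
have nsqM (v w : R[i]) : cre (v * w) ^+ 2 + cim (v * w) ^+ 2 =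
    (cre v ^+ 2 + cim v ^+ 2) * (cre w ^+ 2 + cim w ^+ 2).
  by rewrite creM cimM; ring.
have : cre c ^+ 2 + cim c ^+ 2 <= 0.
  apply: (cL2_infinite_measure mD Doo hL2) => t Dt.
  rewrite (hE t Dt) nsqM; apply: ler_peMl; first by rewrite addr_ge0 ?sqr_ge0.
  by rewrite /cexpR normsq_cexp creMR exprn_ege1// -expR0 ler_expR lam0.
move=> c0; have cr := sqr_ge0 (cre c); have ci := sqr_ge0 (cim c).
apply: complex_ext; apply/eqP; rewrite -sqrf_eq0; apply/eqP; lra.
Qed.

End ExponentialSolutions.

Section Injectivity.
Context {R : realType}.
Local Notation mu := (@lebesgue_measure R).
Variables (m : R) (z s : R[i]).
Hypothesis s_eigen : s * s * (z - RtoC m) = z + RtoC m.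
Local Notation nu := (iC * (s * (z - RtoC m))).

(** By [s_eigen] the row [(1, s)] is a left eigenvector of [i sigma1 (z - m sigma3)] with eigenvalue
    [nu]. It is used for [s = zeta] and [s = - zeta], where [nu] is [i k] and [- i k]. *)
Let Dexpr_eq0 (u g : R -> 'cV[R[i]]_2) x : Dexpr m u g x - z *: u x = 0 ->
  g x ord0 0 + s * g x ord_max 0 = nu * (u x ord0 0 + s * u x ord_max 0).
Proof.
move=> e; have := congr1 (fun w : 'cV[R[i]]_2 => w ord0 0) e.
have := congr1 (fun w : 'cV[R[i]]_2 => w ord_max 0) e.
rewrite /Dexpr !cV2E [RHS]mxE => e1 e0; rewrite mxE in e0.
move: e0 e1; set g0 := g x ord0 0; set g1 := g x ord_max 0.
set u0 := u x ord0 0; set u1 := u x ord_max 0 => e0 e1.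
apply/subr0_eq.
(* The difference of the two sides, written as a combination of quantities that vanish: [1 + i^2],
   the two components of the equation, and the defect of [s_eigen]. *)
transitivity ((1 + iC * iC) * (g0 + s * g1) + iC * s * (- iC * g1 + RtoC m * u0 - z * u0) +
   iC * (- iC * g0 + RtoC m * (- u1) - z * u1) +
   iC * u1 * (z + RtoC m - s * s * (z - RtoC m))); first by ring.
by rewrite iC_sqr addrN mul0r e0 e1 s_eigen subrr !mulr0 !addr0.
Qed.

Variables (u g : R -> 'cV[R[i]]_2) (c : 'cV[R[i]]_2).
Let w t := u t ord0 0 + s * u t ord_max 0.
Let w0 := c ord0 0 + s * c ord_max 0.

Let cL2_combination (D : set (measurableTypeR R)) (F : R -> 'cV[R[i]]_2) : measurable D ->
  L2on D F -> cL2 D (fun t => F t ord0 0 + s * F t ord_max 0).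
Proof. by move=> mD /(L2onP _ mD) FL2; apply: cL2D => //; exact: cL2Z. Qed.

Let cL2_itv (a b : R) h : cL2 `]a, b] h -> cintegrable `]a, b] h.
Proof. by apply: cL2_cintegrable => //; exact: subset_itv_oc_cc. Qed.

Lemma solution_pos : H1_pos u g c ->
  {ae leb, forall x, 0 < x -> Dexpr m u g x - z *: u x = 0} ->
  (forall t, 0 < t -> w t = cexpR nu t * w0) /\ (0 <= cre nu -> w0 = 0).
Proof.
move=> [uL2 [gL2 uE]] ode.
have wE t : 0 < t -> w t = cexpR nu t * w0.
  (* [u 0] is arbitrary, so [w] may be discontinuous at [0]. [W] agrees with [w] on []0, t]] and
     takes the trace [w0] at [0], which makes it a primitive on the closed interval. *)
  move=> t0; pose W x := w0 + cint [set y | 0 < y <= x] (fun y => g y ord0 0 + s * g y ord_max 0).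
  have sub : (`]0, t] : set R) `<=` Rpos by move=> y; rewrite /= in_itv /= => /andP[].
  have cg : cL2 `]0, t] (fun y => g y ord0 0 + s * g y ord_max 0).
    exact: cL2S measurable_Rpos _ sub (cL2_combination measurable_Rpos gL2).
  have cu : cL2 `]0, t] w.
    exact: cL2S measurable_Rpos _ sub (cL2_combination measurable_Rpos uL2).
  have gi i : cintegrable `]0, t] (fun y => g y i 0).
    apply: cL2_itv; apply: cL2S sub _ => //; first exact: measurable_Rpos.
    exact: ((L2onP _ measurable_Rpos).1 gL2).
  have W0 : W 0 = w0.
    rewrite /W (_ : [set y | 0 < y <= 0] = set0) ?cint_set0 ?addr0//.
    by apply/seteqP; split => y //= /andP[/lt_le_trans h /h]; rewrite ltxx.
  have Ww x : 0 < x <= t -> W x = w x.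
    move=> /andP[x0 xt].
    have subx : `]0, x] `<=` `]0, t] by apply: subset_itvl; rewrite bnd_simp.
    have gxi i : cintegrable `]0, x] (fun y => g y i 0) by exact: cintegrableS subx _.
    rewrite /W /w (uE x x0) set_itv_oc !cV2D !mxE cintD//; last exact: cintegrableZ.
    by rewrite cintZ// /w0; ring.
  have pW : primitive 0 t W (fun y => g y ord0 0 + s * g y ord_max 0).
    split; first exact: cL2_itv cg.
    by move=> x _; rewrite W0 /W set_itv_oc.
  have {}pW : primitive 0 t W (fun y => nu * w y).
    apply: ae_eq_primitive pW; first exact: ltW.
      by apply: cintegrableZ => //; exact: cL2_itv cu.
    by apply: ae_imply ode => x ode /andP[x0 _]; exact/Dexpr_eq0/ode.
  have {}pW : primitive 0 t W (fun y => nu * W y).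
    by apply: eq_primitive pW => [|//|x xt]; rewrite ?(ltW t0)// (Ww x xt).
  have := primitive_exponential (ltW t0) pW.
  by rewrite cexpR0 mul1r W0 (Ww t) ?t0 ?lexx.
split=> // nu0; apply: (exponential_not_L2 measurable_Rpos _ (cL2_combination measurable_Rpos uL2) wE).
  rewrite (_ : Rpos = `]0, +oo[%classic); first by rewrite [LHS]lebesgue_measure_itv /= ltry.
  by apply/seteqP; split => x; rewrite /Rpos /= in_itv /= andbT.
by move=> t /ltW t0; exact: mulr_ge0.
Qed.

Lemma solution_neg : H1_neg u g c ->
  {ae leb, forall x, x < 0 -> Dexpr m u g x - z *: u x = 0} ->
  (forall t, t < 0 -> w t = cexpR nu t * w0) /\ (cre nu <= 0 -> w0 = 0).
Proof.
move=> [uL2 [gL2 uE]] ode.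
have wE t : t < 0 -> w t = cexpR nu t * w0.
  move=> t0; pose gs y := g y ord0 0 + s * g y ord_max 0.
  pose W x := w0 - cint [set y | x <= y < 0] gs.
  have sub : (`]t, 0[ : set R) `<=` Rneg by move=> y; rewrite /= in_itv /= => /andP[].
  have ext k : cL2 Rneg k -> cintegrable `]t, 0] k.
    move=> /(cL2S measurable_Rneg (measurable_itv `]t, 0[) sub).
    move=> /(cL2_cintegrable (measurable_itv `]t, 0[) (@subset_itv_oo_cc _ R t 0)).
    exact: cintegrable_itv_bndo_bndc.
  have gsi : cintegrable `]t, 0] gs by apply: ext; exact: cL2_combination measurable_Rneg gL2.
  have wi : cintegrable `]t, 0] w by apply: ext; exact: cL2_combination measurable_Rneg uL2.
  have gi i : cintegrable `]t, 0] (fun y => g y i 0).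
    by apply: ext; exact: ((L2onP _ measurable_Rneg).1 gL2).
  have co (k : R -> R[i]) x : t <= x -> cintegrable `]t, 0] k ->
      cint [set y | x <= y < 0] k = cint `]x, 0] k.
    move=> tx ki; have kx : cintegrable `]x, 0[ k.
      by apply: cintegrableS ki => //; apply: subset_itv; rewrite bnd_simp.
    by rewrite set_itv_co -(cint_itv_bndo_bndc kx) -(cint_itv_obnd_cbnd kx).
  have W0 : W 0 = w0.
    rewrite /W (_ : [set y | 0 <= y < 0] = set0) ?cint_set0 ?subr0//.
    by apply/seteqP; split => y //= /andP[/le_lt_trans h /h]; rewrite ltxx.
  have Ww x : t <= x < 0 -> W x = w x.
    move=> /andP[tx x0].
    have gxi i : cintegrable `]x, 0] (fun y => g y i 0).
      by apply: cintegrableS (gi i) => //; apply: subset_itvr; rewrite bnd_simp.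
    rewrite /W /w (uE x x0) co// /gs !cV2D !cV2N !mxE cintD//; last exact: cintegrableZ.
    by rewrite !co// cintZ// /w0; ring.
  have pW : primitive t 0 W gs.
    split=> // x /andP[tx x0]; rewrite /W !co//.
    have E : `]t, 0]%classic = `]t, x] `|` `]x, 0] :> set R by rewrite -itv_bndbnd_setU.
    rewrite E cint_setU//.
    - by rewrite opprD addrA addrAC subrK.
    - by rewrite -E.
    - rewrite disj_set2E; apply/eqP; rewrite -subset0 => y [] /=.
      by rewrite !in_itv /= => /andP[_ h] /andP[/(le_lt_trans h)]; rewrite ltxx.
  have {}pW : primitive t 0 W (fun y => nu * W y).
    apply: ae_eq_primitive pW; first exact: ltW.
      apply: cintegrable_itv_bndo_bndc.
      have wi' : cintegrable `]t, 0[ (fun y => nu * w y).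
        by apply: cintegrableZ => //; apply: cintegrableS wi => //; apply: subset_itvl; rewrite bnd_simp.
      apply: eq_cintegrable wi' => // y; rewrite inE /= in_itv /= => /andP[ty y0].
      by rewrite Ww// (ltW ty).
    (* The interval contains its endpoint [0], where the equation says nothing; that point is
       discarded as a null set. *)
    apply: ae_imply (ae_and ode (ae_neq 0)) => x [odex /eqP xn0] /andP[tx x0].
    have {}x0 : x < 0 by rewrite lt_neqAle xn0.
    by rewrite Ww ?x0 ?(ltW tx)//; exact/Dexpr_eq0/odex.
  have := primitive_exponential (ltW t0) pW.
  by rewrite cexpR0 mul1r W0 (Ww t) ?t0 ?lexx => // ->.
split=> // nu0; apply: (exponential_not_L2 measurable_Rneg _ (cL2_combination measurable_Rneg uL2) wE).
  by rewrite (_ : Rneg = `]-oo, 0[%classic)// [LHS]lebesgue_measure_itv /= ltNyr.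
by move=> t /ltW t0; exact: mulr_le0.
Qed.

End Injectivity.

Lemma both_zero (F : numFieldType) (a p q : F) : a != 0 ->
  p + a * q = 0 -> p - a * q = 0 -> p = 0 /\ q = 0.
Proof.
move=> aN0 e1 e2.
have pE : p = (p + a * q + (p - a * q)) / 2%:R by field.
have qE : q = (p + a * q - (p - a * q)) / (2%:R * a) by field.
by split; [rewrite pE|rewrite qE]; rewrite e1 e2 ?addr0 ?subr0 mul0r.
Qed.

(** * Resolvent set and resolvent of [D_A] *)

Section ResolventSet.
Context {R : realType}.
Variables (m : R) (A : 'M[R[i]]_2) (z : R[i]).
Hypothesis z_resolvent : ~ (cim z = 0 /\ `|m| <= `|cre z|).
Hypothesis det_neq0 : \det (sigma0 + (iC / 2%:R) *: (A *m Zmat m z)) != 0.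
Local Notation zt := (zeta m z).
Local Notation lam := (iC * kz m z).

(* [cp] and [cm] are multiples of [(zeta, 1)] and [(- zeta, 1)]; then
   [h = - i sigma1 (cp - cm)] satisfies [i Z h = cp + cm], so the transmission
   condition reads [(1 + i/2 A Z) h = 0]. *)
Lemma transmission_eq0 (cm cp : 'cV[R[i]]_2) :
  ((2%:R * iC) *: sigma1 - A) *m cp = ((2%:R * iC) *: sigma1 + A) *m cm ->
  cp ord0 0 - zt * cp ord_max 0 = 0 -> cm ord0 0 + zt * cm ord_max 0 = 0 ->
  cp = 0 /\ cm = 0.
Proof.
move=> tr /eqP; rewrite subr_eq0 => /eqP p0 /eqP; rewrite addr_eq0 => /eqP m0.
have zN0 := zeta_neq0 z_resolvent.
pose h := - iC *: (sigma1 *m (cp - cm)).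
have Zh : Zmat m z *m h = - iC *: (cp + cm).
  rewrite /h -scalemxAr; congr (_ *: _); apply: cV2_ext.
  - by rewrite Zmat_fst sigma1_fst !cV2D cV2N p0 m0; ring.
  - by rewrite Zmat_snd sigma1_snd !cV2D cV2N p0 m0; field.
have h0 : h = 0.
  have Bu : sigma0 + (iC / 2%:R) *: (A *m Zmat m z) \in unitmx.
    by rewrite unitmxE unitfE.
  rewrite -[h](mulKmx Bu) (_ : _ *m h = 0) ?mulmx0//.
  rewrite mulmxDl -scalemxAl -mulmxA Zh /sigma0 mul1mx.
  have : (2%:R * iC) *: (sigma1 *m (cp - cm)) = A *m (cp + cm).
    rewrite mulmxBl mulmxDl -!scalemxAl in tr.
    rewrite mulmxBr mulmxDr scalerBr; apply/subr0_eq.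
    by rewrite opprD addrACA -opprD tr subrr.
  rewrite -scalemxAr scalerA => <-.
  rewrite /h scalerA -scalerDl (_ : _ + _ = 0) ?scale0r//.
  have -> : - iC + iC / 2%:R * - iC * (2%:R * iC) = - iC * (1 + iC * iC) :> R[i] by field.
  by rewrite iC_sqr subrr mulr0.
have e : cp = cm.
  apply/subr0_eq; rewrite -[LHS]mul1mx -sigma1_sqr -mulmxA.
  have -> : sigma1 *m (cp - cm) = iC *: h.
    by rewrite /h scalerA mulrN iC_sqr opprK scale1r.
  by rewrite h0 scaler0 mulmx0.
rewrite e in p0; have [c0 c1] : cm ord0 0 = 0 /\ cm ord_max 0 = 0.
  by apply: (both_zero zN0); [rewrite m0 addNr|rewrite p0 subrr].
have cm0 : cm = 0 by apply: cV2_ext; rewrite ?c0 ?c1 mxE.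
by rewrite e cm0.
Qed.

(** The mode with exponent [- lam] grows at [+oo] and the one with [lam] at [-oo]. Square
    integrability removes the first on the right and the second on the left, which are the two
    linear relations on the traces that [transmission_eq0] requires. Once the traces vanish, so do
    both modes on each side. *)
Lemma DA_injective (u gm gp : R -> 'cV[R[i]]_2) (cm cp : 'cV[R[i]]_2) :
  in_dom_DA A u gm gp cm cp ->
  {ae leb, forall x, x < 0 -> Dexpr m u gm x - z *: u x = 0} ->
  {ae leb, forall x, 0 < x -> Dexpr m u gp x - z *: u x = 0} ->
  {ae leb, forall x, u x = 0}.
Proof.
move=> [Hm [Hp tr]] odem odep.
have kap0 := kz_gt0 z_resolvent; have zN0 := zeta_neq0 z_resolvent.
have ep : zt * zt * (z - RtoC m) = z + RtoC m.
  by rewrite -mulrA zeta_zBm// zeta_kz.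
have em : - zt * - zt * (z - RtoC m) = z + RtoC m by rewrite mulrNN.
have nup : iC * (zt * (z - RtoC m)) = lam by rewrite zeta_zBm.
have num : iC * (- zt * (z - RtoC m)) = - lam by rewrite mulNr zeta_zBm// mulrN.
have lam0 : cre lam <= 0 by rewrite cre_iCM oppr_le0 ltW.
have lamN0 : 0 <= cre (- lam) by rewrite creN oppr_ge0.
have [pp _] := solution_pos ep Hp odep; have [pm pm0] := solution_pos em Hp odep.
have [mp mp0] := solution_neg ep Hm odem; have [mm _] := solution_neg em Hm odem.
rewrite nup in pp mp mp0; rewrite num in pm pm0 mm.
have {}pm0 := pm0 lamN0; have {}mp0 := mp0 lam0.
have [cp0 cm0] : cp = 0 /\ cm = 0.
  by apply: transmission_eq0 tr _ mp0; rewrite -mulNr.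
have zero t : u t ord0 0 + zt * u t ord_max 0 = 0 ->
    u t ord0 0 + - zt * u t ord_max 0 = 0 -> u t = 0.
  rewrite mulNr => e1 e2; have [u0 u1] := both_zero zN0 e1 e2.
  by apply: cV2_ext; rewrite ?u0 ?u1 mxE.
apply: ae_imply (ae_neq 0) => x /eqP; rewrite neq_lt => /orP[x0|x0].
- by apply: zero; rewrite ?(mp x x0) ?(mm x x0) cm0 !mxE !mulr0 ?addr0 mulr0.
- by apply: zero; rewrite ?(pp x x0) ?(pm x x0) cp0 !mxE !mulr0 ?addr0 mulr0.
Qed.

Lemma DA_surjective f : L2on setT f -> exists gm gp cm cp,
  in_dom_DA A (intop (RAz m A z) f) gm gp cm cp /\
  {ae leb, forall x, x < 0 ->
     Dexpr m (intop (RAz m A z) f) gm x - z *: intop (RAz m A z) f x = f x} /\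
  {ae leb, forall x, 0 < x ->
     Dexpr m (intop (RAz m A z) f) gp x - z *: intop (RAz m A z) f x = f x}.
Proof.
move=> fL2; have kap0 := kz_gt0 z_resolvent.
have [c c0 cR] := RAz_bound A kap0.
have uL2 := intop_L2on kap0 (RAz_measurable m A z) cR fL2.
apply: (transmission_in_dom z_resolvent det_neq0 fL2 uL2
  (fun c a b ab => vprimitive_free_left kap0 fL2 c ab)
  (fun c a b ab => vprimitive_free_right kap0 fL2 c ab) erefl erefl) => x.
apply: etrans (vint_rank_one _ _ _ (vintegrable_Rz kap0 fL2 x) (vintegrable_Rz kap0 fL2 0)) _.
(* The integral of [R_z(0, y) f(y)] is the free resolvent at the point [0], so [free_resolvent] is
   used both at [x] and at [0]. *)
exact: (congr2 (fun v v0 => v - Rz m z x 0 *m (_ *m A *m v0))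
  (free_resolvent kap0 fL2 x) (free_resolvent kap0 fL2 0)).
Qed.

End ResolventSet.

Theorem theorem3p2 (R : realType) (m : R) (A : 'M[R[i]]_2) (z : R[i]) :
  ~ (cim z = 0 /\ `|m| <= `|cre z|) ->
  \det (sigma0 + (iC / 2%:R) *: (A *m Zmat m z)) != 0 ->
  resolvent_is_intop m A z (RAz m A z).
Proof.
move=> z_resolvent det_neq0; have kap0 := kz_gt0 z_resolvent.
have [c c0 cR] := RAz_bound A kap0.
split; first exact: DA_injective.
split=> [f fL2|].
  split=> [x _|]; last exact: DA_surjective.
  exact (vintegrable_kernel kap0 (RAz_measurable m A z) cR x fL2).
exists (16 * (c * (2 / cim (kz m z))) ^+ 2) => f fL2.
exact (intop_L2sq kap0 (RAz_measurable m A z) cR fL2).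
Qed.
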